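(* Let $\Omega\subset\mathbb{R}^d$ be compact with probability measure $\mu$, let $2\le p<\infty$, $\beta\in(0,1]$, $r>0$, and let $\Psi=\{\psi_{\mathbf k}\}_{\mathbf k\in\mathbb{Z}^d}\subset\mathcal{C}(\Omega)$ be a uniformly bounded Bessel system with constant $K>0$. There exist constants $c=c(r,\beta,p,K,d)$ and $C=C(r,\beta,p,d)$ such that for every $v\in\mathbb{N}$: if $\Psi\in NI(2,p,H,2v)$, then $$\varrho_m^o(\mathbf{A}^r_\beta(\Psi),L_p(\Omega,\mu))\le CH\,v^{1/2-1/\beta-r/d}$$ for every $m\ge c\,v(\log(2v))^4$.
   Context: Uniformly bounded Bessel system: $\sup_{x\in\Omega}|\psi_{\mathbf k}(x)|\le1$ for all $\mathbf k$, and for every finite $Q\subset\mathbb{Z}^d$ and $(a_{\mathbf k})_{\mathbf k\in Q}\subset\mathbb{C}$: $\sum_Q|a_{\mathbf k}|^2\le K\|\sum_Q a_{\mathbf k}\psi_{\mathbf k}\|_{L_2(\Omega,\mu)}^2$. $\Psi\in NI(2,p,H,u)$ means $\|f\|_{L_p(\Omega,\mu)}\le H\|f\|_{L_2(\Omega,\mu)}$ for every linear combination $f$ of at most $u$ elements of $\Psi$. Class $\mathbf{A}^r_\beta(\Psi)$: all $f=\sum_{\mathbf k\in\mathbb{Z}^d}a_{\mathbf k}(f)\psi_{\mathbf k}$ with $\sum_{\mathbf k}|a_{\mathbf k}(f)|<\infty$ and $\big(\sum_{[2^{j-1}]\le\|\mathbf k\|_\infty<2^j}|a_{\mathbf k}(f)|^\beta\big)^{1/\beta}\le2^{-rj}$,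 $j=0,1,\dots$. $\varrho_m^o(\mathbf F,L_p)=\inf_\xi\inf_{\mathcal M}\sup_{f\in\mathbf F}\|f-\mathcal M(f(\xi^1),\dots,f(\xi^m))\|_{L_p(\Omega,\mu)}$, infima over all $m$-point sets $\xi\subset\Omega$ and all mappings $\mathcal M:\mathbb{C}^m\to L_p(\Omega,\mu)$. *)

(* Defs.v *)
From HB Require Import structures.
From mathcomp Require Import all_boot all_order all_algebra.
From mathcomp Require Import all_classical all_reals all_analysis.
From mathcomp.real_closed Require Import complex.

Set Implicit Arguments.
Unset Strict Implicit.
Unset Printing Implicit Defensive.

Import Order.TTheory GRing.Theory Num.Theory.
Import numFieldNormedType.Exports.
Local Open Scope classical_set_scope.
Local Open Scope ring_scope.

Notation Cx R := (complex.complex R).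
Notation normc := ComplexField.Normc.normc.

Definition Rd (R : realType) (d : nat) := g_sigma_algebraType (@open 'rV[R]_d).

Definition supnorm (d : nat) (k : 'rV[int]_d) : nat := \max_(i < d) `|k ord0 i|%N.

(* the j-th dyadic block  [2^(j-1)] <= ||k||_infty < 2^j   ([2^(-1)] = 0) *)
Definition dyadic_block (d j : nat) (k : 'rV[int]_d) : bool :=
  ((2 ^ j)./2 <= supnorm k < 2 ^ j)%N.

Definition CLpnorm (R : realType) (d : nat) (mu : {measure set (Rd R d) -> \bar R})
  (Om : set (Rd R d)) (p : R) (f : 'rV[R]_d -> Cx R) : \bar R :=
  ((\int[mu]_(x in Om) ((normc (f x)) `^ p)%:E) `^ p^-1)%E.

Definition inLp (R : realType) (d : nat) (mu : {measure set (Rd R d) -> \bar R})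
  (Om : set (Rd R d)) (p : R) (f : 'rV[R]_d -> Cx R) : Prop :=
  [/\ measurable_fun Om (fun x : Rd R d => complex.Re (f x)),
      measurable_fun Om (fun x : Rd R d => complex.Im (f x)) &
      (CLpnorm mu Om p f < +oo)%E].

Definition lincomb (R : realType) (d : nat) (psi : 'rV[int]_d -> 'rV[R]_d -> Cx R)
  (Q : seq 'rV[int]_d) (a : 'rV[int]_d -> Cx R) : 'rV[R]_d -> Cx R :=
  fun x => \sum_(k <- Q) a k * psi k x.

Definition bessel (R : realType) (d : nat) (mu : {measure set (Rd R d) -> \bar R})
  (Om : set (Rd R d)) (psi : 'rV[int]_d -> 'rV[R]_d -> Cx R) (K : R) : Prop :=
  forall (Q : seq 'rV[int]_d) (a : 'rV[int]_d -> Cx R), uniq Q ->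
    ((\sum_(k <- Q) normc (a k) ^+ 2)%:E <=
       K%:E * (CLpnorm mu Om 2 (lincomb psi Q a) * CLpnorm mu Om 2 (lincomb psi Q a)))%E.

Definition unif_bounded (R : realType) (d : nat) (Om : set 'rV[R]_d)
  (psi : 'rV[int]_d -> 'rV[R]_d -> Cx R) : Prop :=
  forall k x, Om x -> normc (psi k x) <= 1.

Definition NI (R : realType) (d : nat) (mu : {measure set (Rd R d) -> \bar R})
  (Om : set (Rd R d)) (psi : 'rV[int]_d -> 'rV[R]_d -> Cx R) (p H : R) (u : nat) : Prop :=
  forall (Q : seq 'rV[int]_d) (a : 'rV[int]_d -> Cx R), uniq Q -> (size Q <= u)%N ->
    (CLpnorm mu Om p (lincomb psi Q a) <= H%:E * CLpnorm mu Om 2 (lincomb psi Q a))%E.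

Definition classA (R : realType) (d : nat) (Om : set 'rV[R]_d)
  (psi : 'rV[int]_d -> 'rV[R]_d -> Cx R) (r beta : R) : set ('rV[R]_d -> Cx R) :=
  [set f | exists a : 'rV[int]_d -> Cx R,
    [/\
        (exists M : R, forall Q : seq 'rV[int]_d, uniq Q -> \sum_(k <- Q) normc (a k) <= M),
        (* (sum_{k in block j} |a_k|^beta)^(1/beta) <= 2^(-r j) ; block j is finite *)
        (forall (j : nat) (Q : seq 'rV[int]_d), uniq Q -> all (dyadic_block j) Q ->
           (\sum_(k <- Q) normc (a k) `^ beta) `^ beta^-1 <= 2 `^ (- r * j%:R)) &
        (* f = sum_k a_k psi_k (unconditional convergence, pointwise on Omega) *)
        (forall x, Om x -> forall e : R, 0 < e -> exists Q0 : seq 'rV[int]_d,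
           forall Q : seq 'rV[int]_d, uniq Q -> {subset Q0 <= Q} ->
             normc (f x - lincomb psi Q a x) <= e)]].

Definition recov_err (R : realType) (d : nat) (mu : {measure set (Rd R d) -> \bar R})
  (Om : set (Rd R d)) (p : R) (m : nat) (F : set ('rV[R]_d -> Cx R)) : \bar R :=
  ereal_inf [set e | exists (xi : 'I_m -> 'rV[R]_d)
                            (M : ('I_m -> Cx R) -> ('rV[R]_d -> Cx R)),
     [/\ (forall i, Om (xi i)), (forall y, inLp mu Om p (M y)) &
       e = ereal_sup [set CLpnorm mu Om p (fun x => f x - M (fun i => f (xi i)) x)
                     | f in F]]].

(* Main.v *)
Require Import Defs.
From HB Require Import structures.
From mathcomp Require Import all_boot all_order all_algebra.
From mathcomp Require Import all_classical all_reals all_analysis.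
From mathcomp.real_closed Require Import complex.
From mathcomp Require Import measurable_realfun ring lra zify.

Import Order.TTheory GRing.Theory Num.Theory.
Import numFieldNormedType.Exports.
Local Open Scope classical_set_scope.
Local Open Scope ring_scope.

Set Implicit Arguments.
Unset Strict Implicit.
Unset Printing Implicit Defensive.

(* Two functions of the class with the same samples differ by a function h that
   (up to a uniformly small tail) vanishes at the sample points, so it suffices to
   bound such an h in L_p.  Keep the low frequencies and the large coefficients of
   h, and replace the rest, whose l_1 norm is small, by Maurey's empirical method:
   this gives a 2v-sparse u close to h both in L_p(mu) and in L_2 of the sample.
   If the sample discretizes the L_2 norm of 2v-sparse functions, then
     ||u||_p <= H ||u||_2 <= C H ||u||_{2,sample} <= C H ||u - h||_{2,sample} + tail.

   For the discretization, the Bessel inequality bounds the l_1 norm of the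
   coefficients of u by sqrt(2vK) ||u||_2.  For each dyadic level 2^i of |u|, Maurey
   approximation replaces the set {|u| >= 2^i / 2} by one of finitely many sets,
   exp(O(4^-i v log v log N)) of them, and the sample only has to see each of these
   sets with at least half of its measure, up to an additive error of order
   4^-i / log v.  Summing the levels costs m of order v (log v)^3.

   Both random choices (of the sample and in Maurey's method) are derandomized: the
   points, resp. the dictionary elements, are picked one by one so that an
   exponential potential never exceeds its average. *)

(** The obstacle is to keep [m] almost linear in [v]. A two-sided comparison of the sample with [mu]
    would cost an error of order sqrt(log(number of sets) / m); only an upper bound of [mu] by twice
    the sample frequency is needed, and its error is log(number of sets) / m, without the root.
    Maurey's choice is made for the sum of [mu] and the sample average rather than for each of them,
    so that a single sparse function is good for both. Frequencies are truncated at a fixed power of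
    [v]: high enough for the tail to fall below the target rate, low enough for log N to stay of
    order log v. The Maurey error in L_p and the tail come without the factor [H]. They are absorbed
    because [NI], tested on a single element of the system, forces [H] to be at least 1/2. *)

Section BoundedMeasurable.
Context {R : realType} {d0 : measure_display} {T : measurableType d0}.
Variable Om : set T.
Implicit Types (f g : T -> R) (nu : (T -> R) -> R).

Definition bmeas f :=
  measurable_fun Om f /\ exists M : R, forall x, Om x -> `|f x| <= M.

(** Integration over [Om], the sample average and their sum all occur as [nu]. The total mass is
    left free, since that of the sum is 2. *)
Definition pos_linear nu := [/\
  forall f g, bmeas f -> bmeas g -> nu (fun x => f x + g x) = nu f + nu g,
  forall (c : R) f, bmeas f -> nu (fun x => c * f x) = c * nu f &
  forall f g, bmeas f -> bmeas g -> (forall x, Om x -> f x <= g x) ->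
    nu f <= nu g].

Lemma bmeas_cst (c : R) : bmeas (fun=> c).
Proof. by split; [exact: measurable_cst | exists `|c|]. Qed.

Lemma bmeasD f g : bmeas f -> bmeas g -> bmeas (fun x => f x + g x).
Proof.
move=> [mf [M fM]] [mg [N gN]]; split; first exact: measurable_funD.
by exists (M + N) => x Ox; rewrite (le_trans (ler_normD _ _))// lerD ?fM ?gN.
Qed.

Lemma bmeasM f g : bmeas f -> bmeas g -> bmeas (fun x => f x * g x).
Proof.
move=> [mf [M fM]] [mg [N gN]]; split; first exact: measurable_funM.
by exists (M * N) => x Ox; rewrite normrM ler_pM ?fM ?gN.
Qed.

Lemma bmeasZ (c : R) f : bmeas f -> bmeas (fun x => c * f x).
Proof. exact/bmeasM/bmeas_cst. Qed.

Lemma bmeasB f g : bmeas f -> bmeas g -> bmeas (fun x => f x - g x).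
Proof.
move=> bf bg; rewrite (_ : (fun _ => _) = fun x => f x + -1 * g x).
  by apply: bmeasD => //; exact: bmeasZ.
by apply/funext => x; rewrite mulN1r.
Qed.

Lemma bmeas_sum (I : Type) (r : seq I) (F : I -> T -> R) :
  (forall i, bmeas (F i)) -> bmeas (fun x => \sum_(i <- r) F i x).
Proof.
move=> bF; elim: r => [|i r IHr].
  rewrite (_ : (fun _ => _) = fun=> 0); first exact: bmeas_cst.
  by apply/funext => x; rewrite big_nil.
rewrite (_ : (fun _ => _) = fun x => F i x + \sum_(i <- r) F i x).
  exact: bmeasD.
by apply/funext => x; rewrite big_cons.
Qed.

Lemma bmeas_comp (h : R -> R) f : measurable_fun [set: R] h ->
  (forall M : R, exists N : R, forall y, `|y| <= M -> `|h y| <= N) ->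
  bmeas f -> bmeas (fun x => h (f x)).
Proof.
move=> mh bh [mf [M fM]]; split; first exact: measurableT_comp.
by have [N hN] := bh M; exists N => x Ox; apply/hN/fM.
Qed.

Lemma bmeas_expR f : bmeas f -> bmeas (fun x => expR (f x)).
Proof.
apply: bmeas_comp; first exact: measurable_expR.
move=> M; exists (expR M) => y yM.
by rewrite ger0_norm ?expR_ge0// ler_expR (le_trans (ler_norm _)).
Qed.

Lemma bmeas_normr f : bmeas f -> bmeas (fun x => `|f x|).
Proof.
apply: bmeas_comp; first exact: normr_measurable.
by move=> M; exists M => y; rewrite normr_id.
Qed.

Lemma bmeas_powR (q : R) f : 0 <= q -> bmeas f ->
  bmeas (fun x => `|f x| `^ q).
Proof.
move=> q0 bf; apply: (@bmeas_comp (fun y => `|y| `^ q)) => //.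
  exact: (measurableT_comp (measurable_powR q) (@normr_measurable R setT)).
move=> M; exists (M `^ q) => y yM; rewrite ger0_norm ?powR_ge0//.
by rewrite ge0_ler_powR// ?nnegrE// (le_trans _ yM).
Qed.

Lemma bmeas_geb f (c : R) : bmeas f -> bmeas (fun x => (c <= f x)%R%:R).
Proof.
move=> [mf _]; split; last first.
  by exists 1 => x _; case: (c <= f x); rewrite ?normr1 ?normr0.
rewrite (_ : (fun _ => _) = \1_([set y : R | (c <= y)%R]) \o f); last first.
  by apply/funext => x /=; rewrite indicE; congr (_%:R); rewrite mem_setE.
apply: measurableT_comp => //; apply: measurable_indic.
rewrite (_ : [set y : R | _] = `[c, +oo[%classic); first exact: measurable_itv.
by apply/seteqP; split => y /=; rewrite in_itv/= andbT.
Qed.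

Section PosLinear.
Variable nu : (T -> R) -> R.
Hypothesis hnu : pos_linear nu.

Lemma pos_linear_sum (I : Type) (r : seq I) (F : I -> T -> R) :
  (forall i, bmeas (F i)) ->
  nu (fun x => \sum_(i <- r) F i x) = \sum_(i <- r) nu (F i).
Proof.
have [nuD nuZ _] := hnu; move=> bF; elim: r => [|i r IHr].
  rewrite big_nil -[RHS](mul0r (nu (fun=> 0))) -nuZ; last exact: bmeas_cst.
  by congr nu; apply/funext => x; rewrite big_nil mul0r.
rewrite big_cons -IHr -nuD//; last exact: bmeas_sum.
by congr nu; apply/funext => x; rewrite big_cons.
Qed.

Lemma pos_linear_cst (c : R) : nu (fun=> c) = c * nu (fun=> 1).
Proof.
have [_ nuZ _] := hnu; rewrite -nuZ; last exact: bmeas_cst.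
by congr nu; apply/funext => x; rewrite mulr1.
Qed.

Lemma pos_linear_ge0 f : bmeas f -> (forall x, Om x -> 0 <= f x) -> 0 <= nu f.
Proof.
have [_ _ nule] := hnu; move=> bf f0.
by rewrite -[leLHS](mul0r (nu (fun=> 1))) -pos_linear_cst nule//; exact: bmeas_cst.
Qed.

End PosLinear.

Definition average (xi : seq T) f : R := (size xi)%:R^-1 * \sum_(x <- xi) f x.

Lemma average_pos_linear (xi : seq T) : (forall x, x \in xi -> Om x) ->
  pos_linear (average xi).
Proof.
rewrite /average => Oxi; split => [f g _ _|c f _|f g _ _ fg].
- by rewrite big_split mulrDr.
- by rewrite -mulr_sumr mulrCA.
- rewrite ler_wpM2l ?invr_ge0// big_seq [leRHS]big_seq ler_sum// => x /Oxi.
  exact: fg.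
Qed.

Lemma average_cst1 (xi : seq T) : (0 < size xi)%N -> average xi (fun=> 1) = 1.
Proof.
by move=> s0; rewrite /average big_const_seq count_predT iter_addr_0 mulVf// pnatr_eq0 -lt0n.
Qed.

Lemma pos_linearD nu1 nu2 : pos_linear nu1 -> pos_linear nu2 ->
  pos_linear (fun f => nu1 f + nu2 f).
Proof.
move=> [D1 Z1 l1] [D2 Z2 l2]; split => [f g bf bg|c f bf|f g bf bg fg].
- by rewrite D1// D2// addrACA.
- by rewrite Z1// Z2// mulrDr.
- by rewrite lerD ?l1 ?l2.
Qed.

Variable mu : {measure set T -> \bar R}.
Hypotheses (mOm : measurable Om) (muOm : mu Om = 1%E).

Lemma bmeas_integrable f : bmeas f -> mu.-integrable Om (EFin \o f).
Proof.
move=> [mf [M fM]]; apply: measurable_bounded_integrable => //.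
  by change (mu Om < +oo)%E; rewrite muOm ltry.
by exists M; split; [exact: num_real|move=> N MN x /fM/le_trans; apply; exact: ltW].
Qed.

Lemma Rintegral_pos_linear : pos_linear (fun f => \int[mu]_(x in Om) f x).
Proof.
split => [f g bf bg|c f bf|f g bf bg fg].
- by rewrite RintegralD//; exact: bmeas_integrable.
- by rewrite RintegralZl//; exact: bmeas_integrable.
- by apply: le_Rintegral => //; exact: bmeas_integrable.
Qed.

Lemma Rintegral_cst1 : \int[mu]_(x in Om) (1 : R) = 1.
Proof. by rewrite Rintegral_cst// [X in fine X]muOm mul1r. Qed.

Lemma integral_bmeasE f : bmeas f ->
  (\int[mu]_(x in Om) (f x)%:E)%E = (\int[mu]_(x in Om) f x)%:E.
Proof.
move=> bf; rewrite /Rintegral fineK//.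
by apply: (integrable_fin_num mOm); exact: bmeas_integrable.
Qed.

(** A function exceeding its mean by more than [e] everywhere would contradict integration over a
    probability space. This is the existence step behind the choice of each sample point. *)
Lemma exists_le_Rintegral f (e : R) : bmeas f -> 0 < e ->
  exists2 x, Om x & f x <= \int[mu]_(y in Om) f y + e.
Proof.
move=> bf e0; apply: contrapT => nex.
have [_ _ le_int] := Rintegral_pos_linear.
have /le_int : forall x, Om x -> \int[mu]_(y in Om) f y + e <= f x.
  move=> x Ox; rewrite leNgt; apply/negP => fx; apply: nex; exists x => //.
  exact: ltW.
move=> /(_ (bmeas_cst _) bf); rewrite Rintegral_cst// [X in fine X]muOm mulr1.
by rewrite gerDl leNgt e0.
Qed.

End BoundedMeasurable.

(** * Exponential inequalities *)

Section ExpInequalities.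
Context {R : realType}.
Implicit Types x y : R.

(** Combine e^y <= 1/(1 - y) with (1 + y + 2y^2)(1 - y) = 1 + y^2 (1 - 2y) >= 1. *)
Lemma expR_le_quadratic y : y <= 2^-1 -> expR y <= 1 + y + 2 * y ^+ 2.
Proof.
move=> y2; have d0 : 0 < 1 - y by lra.
have -> : expR y = (expR (- y))^-1 by rewrite expRN invrK.
apply: (@le_trans _ _ (1 - y)^-1).
  by rewrite lef_pV2 ?posrE ?expR_gt0// expR_ge1Dx.
rewrite -[leLHS]mul1r ler_pdivrMr//.
have := sqr_ge0 y; set z := y ^+ 2 => z0.
have -> : (1 + y + 2 * z) * (1 - y) = 1 + z * (1 - 2 * y) by rewrite /z; ring.
by rewrite lerDl mulr_ge0//; lra.
Qed.

Lemma expRN_le_half : expR (-1) <= 2^-1 :> R.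
Proof.
rewrite expRN lef_pV2 ?posrE ?expR_gt0//.
by rewrite (le_trans _ (expR_ge1Dx _)).
Qed.

(** Raise z <= e^z at z = y/q to the power q. This converts one exponential moment into power
    moments of every order. *)
Lemma powR_le_expR q y : 0 < q -> 0 <= y -> y `^ q <= q `^ q * expR y.
Proof.
move=> q0 y0; rewrite -[X in X `^ q <= _](@mulfVK _ q)//; last by rewrite gt_eqF.
rewrite mulrC powRM// ?divr_ge0// ?(ltW q0)//.
rewrite ler_wpM2l ?powR_ge0//.
have yq : y / q <= expR (y / q).
  by rewrite (le_trans _ (expR_ge1Dx _))// lerDr.
rewrite (@le_trans _ _ (expR (y / q) `^ q))//.
  by rewrite ge0_ler_powR// ?nnegrE ?divr_ge0 ?expR_ge0 ?(ltW q0).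
by rewrite -expRM divfK// gt_eqF.
Qed.

End ExpInequalities.

(** * Maurey's empirical method *)

Section FiniteMeans.
Context {R : realType} {J : finType}.
Variable w : J -> R.
Hypotheses (w_ge0 : forall j, 0 <= w j) (w_sum1 : \sum_j w j = 1).

Lemma exists_le_mean (F : J -> R) (c : R) :
  \sum_j w j * F j <= c -> exists j, F j <= c.
Proof.
move=> Fc; apply: contrapT => nex.
have cF j : c < F j by rewrite ltNge; apply/negP => Fj; apply: nex; exists j.
have [j wj] : exists j, 0 < w j.
  apply: contrapT => nw.
  have w0 j : w j = 0.
    apply/eqP; apply: contra_notT nw => wj; exists j.
    by rewrite lt_neqAle eq_sym wj w_ge0.
  move: (oner_neq0 R); rewrite -w_sum1 big1 ?eqxx//.
have : \sum_j w j * F j > \sum_j w j * c.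
  rewrite (bigD1 j)//= [ltRHS](bigD1 j)//= ltr_leD//.
    by rewrite ltr_pM2l.
  by rewrite ler_sum// => i _; rewrite ler_wpM2l// ltW.
by rewrite -mulr_suml w_sum1 mul1r ltNge Fc.
Qed.

(** [X] is centred, so the linear term of the quadratic bound averages out; |c X| <= 1/2 keeps the
    exponent in range, and 2 (2c)^2 = 8 c^2. *)
Lemma exp_mean_le (X : J -> R) (c : R) : `|c| <= 4^-1 ->
  (forall j, `|X j| <= 2) -> \sum_j w j * X j = 0 ->
  \sum_j w j * expR (c * X j) <= expR (8 * c ^+ 2).
Proof.
move=> c4 X2 X0.
apply: (@le_trans _ _ (\sum_j (w j + c * (w j * X j) + w j * (8 * c ^+ 2)))).
  apply: ler_sum => j _.
  have -> : w j + c * (w j * X j) + w j * (8 * c ^+ 2) =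
            w j * (1 + c * X j + 8 * c ^+ 2) by ring.
  rewrite ler_wpM2l//; apply: le_trans (expR_le_quadratic _) _.
    apply: le_trans (ler_norm _) _; rewrite normrM.
    apply: le_trans (ler_pM _ _ c4 (X2 j)) _ => //.
    by rewrite -[leRHS]mul1r; lra.
  rewrite lerD2l exprMn.
  have : `|X j| ^+ 2 <= 2 ^+ 2 by rewrite ler_sqr ?nnegrE.
  rewrite real_normK ?num_real// => X4.
  have := sqr_ge0 c; set z := c ^+ 2 => z0.
  have : z * X j ^+ 2 <= z * 2 ^+ 2 by rewrite ler_wpM2l.
  by rewrite (_ : 2 ^+ 2 = 4) ?expr2//; lra.
rewrite !big_split/= -mulr_sumr X0 mulr0 addr0 -mulr_suml w_sum1 mul1r.
exact: expR_ge1Dx.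
Qed.

End FiniteMeans.

Section Maurey.
Context {R : realType} {d0 : measure_display} {T : measurableType d0}.
Variables (Om : set T) (nu : (T -> R) -> R).
Hypothesis hnu : pos_linear Om nu.
Variables (J : finType) (phi : bool -> J -> T -> R) (w : J -> R).
Hypotheses (w_ge0 : forall j, 0 <= w j) (w_sum1 : \sum_j w j = 1).
Hypothesis phi_bmeas : forall b j, bmeas Om (phi b j).
Hypothesis phi_le1 : forall b j x, Om x -> `|phi b j x| <= 1.

Definition wmean b x := \sum_j w j * phi b j x.

Definition deviation b (s : seq J) x := \sum_(j <- s) (phi b j x - wmean b x).

(** [q.1] will be the real or imaginary part and [q.2] is a sign: the two signs together dominate
    the exponential of the absolute deviation. *)
Definition exp_potential (lam : R) (s : seq J) x :=
  \sum_(q : bool * bool) expR ((-1) ^+ q.2 * lam * deviation q.1 s x).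

Lemma bmeas_wmean b : bmeas Om (wmean b).
Proof. by apply: bmeas_sum => j; exact: bmeasZ. Qed.

Lemma bmeas_deviation b s : bmeas Om (deviation b s).
Proof. by apply: bmeas_sum => j; apply: bmeasB => //; exact: bmeas_wmean. Qed.

Lemma bmeas_exp_potential lam s : bmeas Om (exp_potential lam s).
Proof.
apply: bmeas_sum => q; apply: bmeas_expR; apply: bmeasZ.
exact: bmeas_deviation.
Qed.

Lemma wmean_le1 b x : Om x -> `|wmean b x| <= 1.
Proof.
move=> Ox; rewrite (le_trans (ler_norm_sum _ _ _))// -w_sum1 ler_sum// => j _.
by rewrite normrM ger0_norm// ler_piMr// phi_le1.
Qed.

Lemma exp_potential_step lam s x : 0 <= lam <= 4^-1 -> Om x ->
  \sum_j w j * exp_potential lam (j :: s) x <=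
  expR (8 * lam ^+ 2) * exp_potential lam s x.
Proof.
move=> /andP[l0 l4] Ox; rewrite /exp_potential.
under eq_bigr do rewrite mulr_sumr.
rewrite exchange_big/= mulr_sumr; apply: ler_sum => -[b t] _ /=.
under eq_bigr => j _.
  rewrite /deviation big_cons mulrDr expRD mulrCA mulrA -/(deviation b s x) mulrC.
  over.
rewrite -mulr_sumr mulrC ler_wpM2r ?expR_ge0//.
under eq_bigr do rewrite mulrC.
have -> : lam ^+ 2 = ((-1) ^+ t * lam) ^+ 2 by rewrite exprMn sqrr_sign mul1r.
apply: exp_mean_le => //.
- by rewrite normrM normr_sign mul1r ger0_norm.
- move=> j; rewrite (le_trans (ler_normB _ _))// (_ : 2 = 1 + 1)// lerD//.
    exact: phi_le1.
  exact: wmean_le1.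
- under eq_bigr do rewrite mulrBr.
  by rewrite sumrB -mulr_suml w_sum1 mul1r subrr.
Qed.

(* Each new index is picked so that the exponential potential does not exceed
   its average over the weights. *)
Lemma maurey_exp lam n : 0 <= lam <= 4^-1 -> exists2 s : seq J, size s = n &
  nu (exp_potential lam s) <= 4 * expR (8 * n%:R * lam ^+ 2) * nu (fun=> 1).
Proof.
move=> hl; have [_ nuZ nule] := hnu; elim: n => [|n [s sn IH]].
  exists [::] => //; rewrite (_ : exp_potential lam [::] = fun=> 4).
    by rewrite (pos_linear_cst hnu) mulr0 mul0r expR0 mulr1.
  apply/funext => x; rewrite /exp_potential.
  under eq_bigr do rewrite /deviation big_nil mulr0 expR0.
  by rewrite sumr_const card_prod card_bool.
have step : \sum_j w j * nu (exp_potential lam (j :: s)) <=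
            expR (8 * lam ^+ 2) * nu (exp_potential lam s).
  under eq_bigr => j _ do rewrite -(nuZ _ _ (bmeas_exp_potential _ _)).
  rewrite -(pos_linear_sum hnu); last first.
    by move=> j; apply: bmeasZ; exact: bmeas_exp_potential.
  rewrite -nuZ; last exact: bmeas_exp_potential.
  apply: nule => [||x Ox].
  - by apply: bmeas_sum => j; apply: bmeasZ; exact: bmeas_exp_potential.
  - by apply: bmeasZ; exact: bmeas_exp_potential.
  - exact: exp_potential_step.
have [j jle] := exists_le_mean w_ge0 w_sum1 step.
exists (j :: s); first by rewrite /= sn.
apply: le_trans jle _; apply: le_trans (ler_wpM2l (expR_ge0 _) IH) _.
rewrite mulrA mulrCA -expRD ler_wpM2r//.
  by apply: (pos_linear_ge0 hnu) => //; exact: bmeas_cst.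
by rewrite -(natr1 n) (_ : 8 * lam ^+ 2 + _ = 8 * (n%:R + 1) * lam ^+ 2)//; ring.
Qed.

Lemma expR_normr_le_potential lam s b x : 0 <= lam ->
  expR (lam * `|deviation b s x|) <=
  \sum_(t : bool) expR ((-1) ^+ t * lam * deviation b s x).
Proof.
move=> l0; rewrite big_bool/= expr1 expr0 mul1r mulN1r.
have [D0|D0] := ger0P (deviation b s x).
  by rewrite lerDr expR_ge0.
by rewrite mulrN mulNr lerDl expR_ge0.
Qed.

Lemma exp_potentialE lam s x : exp_potential lam s x =
  \sum_(b : bool) \sum_(t : bool) expR ((-1) ^+ t * lam * deviation b s x).
Proof. by rewrite /exp_potential pair_bigA. Qed.

Lemma maurey_tail n (rho : R) : 0 <= rho <= 4 ->
  exists2 s : seq J, size s = n &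
  nu (fun x => \sum_(b : bool) (n%:R * rho <= `|deviation b s x|)%R%:R) <=
    4 * expR (- (n%:R * rho ^+ 2 / 32)) * nu (fun=> 1).
Proof.
move=> /andP[rho0 rho4]; have [_ nuZ nule] := hnu.
(* [lam = rho / 16] minimizes 8 n lam^2 - lam n rho, with value -n rho^2 / 32. *)
have hl : 0 <= rho / 16 <= 4^-1 by apply/andP; split; lra.
have [s sn Hs] := maurey_exp n hl; exists s => //.
apply: (@le_trans _ _ (expR (- (n%:R * rho ^+ 2 / 16)) *
                       nu (exp_potential (rho / 16) s))); last first.
  apply: le_trans (ler_wpM2l (expR_ge0 _) Hs) _.
  rewrite mulrA mulrCA -expRD.
  by rewrite (_ : - _ + _ = - (n%:R * rho ^+ 2 / 32)) ?lexx//; field.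
rewrite -nuZ; last exact: bmeas_exp_potential.
apply: nule => [||x Ox].
- apply: bmeas_sum => b; apply: bmeas_geb; apply: bmeas_normr.
  exact: bmeas_deviation.
- by apply: bmeasZ; exact: bmeas_exp_potential.
rewrite exp_potentialE mulr_sumr ler_sum// => b _.
have [le|_] := boolP (_ <= `|deviation b s x|)%R; last first.
  by rewrite mulr_ge0 ?expR_ge0// sumr_ge0// => t _; exact: expR_ge0.
have l0 : 0 <= rho / 16 by lra.
apply: le_trans _ (ler_wpM2l (expR_ge0 _) (expR_normr_le_potential s b x l0)).
rewrite -expRD -[leLHS]expR0 ler_expR.
have : rho / 16 * (n%:R * rho) <= rho / 16 * `|deviation b s x|.
  by rewrite ler_wpM2l.
rewrite (_ : rho / 16 * (n%:R * rho) = n%:R * rho ^+ 2 / 16); last by ring.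
by rewrite -[X in X <= _](addr0 _) => h; rewrite addrC subr_ge0 -[leLHS]addr0.
Qed.

(** [s] is fixed before [q]: one exponential potential bounds all moments of the same [s]. Later q =
    2 serves the sample and q = p the measure. *)
Lemma maurey_moments n : (0 < n)%N -> exists2 s : seq J, size s = n &
  forall q : R, 0 < q ->
  nu (fun x => \sum_(b : bool) `|deviation b s x| `^ q) <=
    (4 * q * Num.sqrt n%:R) `^ q * (4 * expR 2^-1) * nu (fun=> 1).
Proof.
move=> n0; have [_ nuZ nule] := hnu.
have n1 : (1 : R) <= n%:R by rewrite ler1n.
have sn1 : (1 : R) <= Num.sqrt n%:R by rewrite -[leLHS]sqrtr1 ler_sqrt// ltr0n.
set rn := Num.sqrt n%:R in sn1 *.
have rn0 : 0 < rn by exact: lt_le_trans sn1.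
(* At this scale 8 n lam^2 = 1/2, so the potential stays bounded while deviations are measured in
   units of sqrt n. *)
set lam := (4 * rn)^-1.
have lam0 : 0 < lam by rewrite invr_gt0 mulr_gt0.
have hl : 0 <= lam <= 4^-1.
  by rewrite ltW//= /lam lef_pV2 ?posrE ?mulr_gt0//; lra.
have [s sn Hs] := maurey_exp n hl; exists s => // q q0.
have E : 8 * n%:R * lam ^+ 2 = 2^-1.
  have -> : n%:R = rn ^+ 2 :> R by rewrite sqr_sqrtr.
  by rewrite /lam; field; rewrite gt_eqF.
rewrite E in Hs.
have -> : 4 * q * rn = q / lam by rewrite /lam invrK; ring.
apply: (@le_trans _ _ ((q / lam) `^ q * nu (exp_potential lam s))); last first.
  by rewrite -mulrA ler_wpM2l ?powR_ge0.
rewrite -nuZ; last exact: bmeas_exp_potential.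
apply: nule => [||x Ox].
- by apply: bmeas_sum => b; apply: bmeas_powR;
    [exact: ltW|exact: bmeas_deviation].
- by apply: bmeasZ; exact: bmeas_exp_potential.
rewrite exp_potentialE mulr_sumr ler_sum// => b _.
apply: le_trans _ (ler_wpM2l (powR_ge0 _ _)
  (expR_normr_le_potential s b x (ltW lam0))).
rewrite -[X in X `^ q <= _](@mulKf _ lam) ?gt_eqF//.
have lam0' : 0 <= lam^-1 by rewrite invr_ge0 ltW.
rewrite (powRM q (ltW q0) lam0') [leLHS]powRM// ?mulr_ge0 ?(ltW lam0)//.
rewrite [q `^ q * _]mulrC -mulrA ler_wpM2l ?powR_ge0//.
by rewrite powR_le_expR// mulr_ge0// ltW.
Qed.

End Maurey.

(** * Choice of the sample *)

Section SelectPoints.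
Context {R : realType} {d0 : measure_display} {T : measurableType d0}.
Variables (Om : set T) (mu : {measure set T -> \bar R}).
Hypotheses (mOm : measurable Om) (muOm : mu Om = 1%E).
Variables (J : finType) (B : J -> T -> R) (w : J -> R).
Hypotheses (w_gt0 : forall j, 0 < w j) (w_sum : \sum_j w j <= 1).
Hypothesis B_bmeas : forall j, bmeas Om (B j).
Hypothesis B01 : forall j x, B j x = 0 \/ B j x = 1.

Let I f := \int[mu]_(x in Om) f x.

(** Controls the event that some [B j] is seen too rarely by the sample. The factor 1 - B/2 is
    affine in B, so its mean is 1 - I(B)/2 <= e^(-I(B)/2), which the growth of the exponential
    compensates; for B in {0, 1} it is also at least e^(-B), which brings back the number of
    hits. *)
Definition sample_potential (xi : seq T) :=
  \sum_j w j * expR ((size xi)%:R * I (B j) / 2) *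
    \prod_(x <- xi) (1 - B j x / 2).

Lemma sample_potential_step xi (e : R) : 0 < e ->
  exists2 x, Om x & sample_potential (x :: xi) <= sample_potential xi + e.
Proof.
move=> e0; have hI := Rintegral_pos_linear mOm muOm.
have [ID IZ Ile] := hI.
have [c cE] : {c : J -> R | forall j, c j =
    w j * expR ((size xi).+1%:R * I (B j) / 2) *
    \prod_(x <- xi) (1 - B j x / 2)} by eexists => j; reflexivity.
have c0 j : 0 <= c j.
  rewrite cE mulr_ge0//; first by rewrite mulr_ge0 ?expR_ge0 ?(ltW (w_gt0 _)).
  by apply: prodr_ge0 => x _; case: (B01 j x) => ->; lra.
have bf j : bmeas Om (fun x => c j + (- c j / 2) * B j x).
  by apply: bmeasD; [exact: bmeas_cst|exact: bmeasZ].
have E x : sample_potential (x :: xi) = \sum_j (c j + (- c j / 2) * B j x).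
  by apply: eq_bigr => j _; rewrite cE big_cons /=; ring.
have bS : bmeas Om (fun x => \sum_j (c j + (- c j / 2) * B j x)).
  exact: bmeas_sum.
have [x Ox xle] := exists_le_Rintegral mOm muOm bS e0.
exists x => //; rewrite E; apply: le_trans xle _; rewrite lerD2r.
rewrite (pos_linear_sum hI _ bf); apply: ler_sum => j _.
rewrite ID; [rewrite IZ//|exact: bmeas_cst|exact: bmeasZ].
rewrite (pos_linear_cst hI) Rintegral_cst1// mulr1.
rewrite -/(I (B j)).
rewrite cE -(natr1 (size xi)) mulrDl mul1r mulrDl expRD.
set P := \prod_(x <- _) _; set a := expR (_ * _ / 2); set y := I (B j).
have P0 : 0 <= P by apply: prodr_ge0 => z _; case: (B01 j z) => ->; lra.
rewrite (_ : _ + _ = w j * a * P * (expR (y / 2) * (1 - y / 2))); last by ring.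
rewrite -[leRHS]mulr1 ler_wpM2l//.
  by rewrite !mulr_ge0 ?expR_ge0 ?(ltW (w_gt0 _)).
rewrite -[leRHS](expRxMexpNx_1 (y / 2)) ler_wpM2l ?expR_ge0//.
exact: expR_ge1Dx.
Qed.

Lemma select_points m : (0 < m)%N -> exists xi : seq T,
  [/\ size xi = m, forall x, x \in xi -> Om x &
    forall j, I (B j) <=
      2 * average xi (B j) + 2 * (ln 2 - ln (w j)) / m%:R].
Proof.
move=> m0; have m0' : (0 : R) < m%:R by rewrite ltr0n.
have [xi [sxi Oxi Pxi]] : exists xi : seq T, [/\ size xi = m,
    forall x, x \in xi -> Om x & sample_potential xi <= 1 + m%:R * m%:R^-1].
  (* Each point may lose 1/m over the mean, for a total loss of 1. Only the two counting occurrences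
     of [m] are generalized; the loss per step stays fixed. *)
  elim: {1 2}m => [|n [xi [sxi Oxi IH]]].
    exists [::]; split => //; rewrite mul0r addr0 (le_trans _ w_sum)//.
    by apply: ler_sum => j _; rewrite big_nil !mul0r expR0 !mulr1.
  have [x Ox xle] := @sample_potential_step xi m%:R^-1 ltac:(by rewrite invr_gt0).
  exists (x :: xi); split; first by rewrite /= sxi.
    by move=> y; rewrite inE => /predU1P[->//|]; exact: Oxi.
  by rewrite (le_trans xle)// -(natr1 n) mulrDl mul1r addrA lerD2r.
exists xi; split => // j.
rewrite divff ?gt_eqF// in Pxi.
(* All terms of the potential are nonnegative, so each one is at most 2; the claim is the logarithm
   of this bound. *)
have Pj : w j * expR (m%:R * I (B j) / 2) * expR (- \sum_(x <- xi) B j x) <= 2.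
  rewrite (_ : 2 = 1 + 1)//; apply: le_trans _ Pxi.
  rewrite /sample_potential (bigD1 j)//= sxi -[leLHS]addr0 lerD//; last first.
    rewrite sumr_ge0// => i _; rewrite mulr_ge0//.
      by rewrite mulr_ge0 ?expR_ge0 ?(ltW (w_gt0 _)).
    by apply: prodr_ge0 => x _; case: (B01 i x) => ->; lra.
  rewrite ler_wpM2l//; first by rewrite mulr_ge0 ?expR_ge0 ?(ltW (w_gt0 _)).
  rewrite -sumrN expR_sum ler_prod// => x _; rewrite expR_ge0/=.
  case: (B01 j x) => ->; first by rewrite oppr0 expR0 mul0r subr0.
  by rewrite (le_trans expRN_le_half)//; lra.
have : ln (w j * expR (m%:R * I (B j) / 2) * expR (- \sum_(x <- xi) B j x)) <= ln 2.
  by rewrite ler_ln// posrE ?mulr_gt0 ?expR_gt0.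
rewrite !lnM ?posrE ?mulr_gt0 ?expR_gt0// !expRK => H.
rewrite /average sxi -(ler_pM2l m0').
rewrite mulrDr [leRHS](_ : _ =
  2 * \sum_(x <- xi) B j x + 2 * (ln 2 - ln (w j))); first by lra.
by field; rewrite gt_eqF.
Qed.

End SelectPoints.

(** * Complex values through their real and imaginary parts *)

Section ComplexParts.
Context {R : realType}.
Implicit Types z y : Cx R.

Definition cpart (b : bool) z : R := if b then complex.Im z else complex.Re z.

Lemma cpart_sum b (I : Type) (r : seq I) (F : I -> Cx R) :
  cpart b (\sum_(i <- r) F i) = \sum_(i <- r) cpart b (F i).
Proof.
rewrite (big_morph (cpart b) (id1 := 0) (op1 := +%R))//; last by case: b.
by move=> [? ?] [? ?]; case: b.
Qed.

Lemma cpartB b z y : cpart b (z - y) = cpart b z - cpart b y.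
Proof. by case: z y => [? ?] [? ?]; case: b. Qed.

Lemma cpartZ b (c : R) z : cpart b (real_complex R c * z) = c * cpart b z.
Proof. by case: z => ? ?; case: b => /=; ring. Qed.

Lemma normc_ge0 z : 0 <= normc z.
Proof. by case: z => ? ?; exact: sqrtr_ge0. Qed.

Lemma sqr_normc_cpart z : normc z ^+ 2 = cpart false z ^+ 2 + cpart true z ^+ 2.
Proof. by case: z => a b /=; rewrite sqr_sqrtr// addr_ge0// sqr_ge0. Qed.

Lemma cpart_le_normc b z : `|cpart b z| <= normc z.
Proof.
rewrite -(@ler_pXn2r _ 2)// ?nnegrE ?normc_ge0// real_normK ?num_real//.
by rewrite sqr_normc_cpart; case: b; rewrite ?lerDr ?lerDl sqr_ge0.
Qed.

Lemma normc_le_cpart z : normc z <= \sum_(b : bool) `|cpart b z|.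
Proof.
rewrite -(@ler_pXn2r _ 2)// ?nnegrE ?normc_ge0 ?sumr_ge0//.
rewrite sqr_normc_cpart big_bool/= sqrrD !real_normK ?num_real//.
have : 0 <= `|complex.Im z| * `|complex.Re z| *+ 2 by rewrite mulrn_wge0 ?mulr_ge0.
lra.
Qed.

Lemma normcD z y : normc (z + y) <= normc z + normc y.
Proof.
have := ler_normD (z : (R[i])%C) y.
by rewrite !normc_def/= -rmorphD/= lecR; case: z y => [? ?] [? ?].
Qed.

Lemma normcN z : normc (- z) = normc z.
Proof. by case: z => a b /=; rewrite !sqrrN. Qed.

Lemma normcB z y : normc (z - y) <= normc z + normc y.
Proof. by rewrite -(normcN y) normcD. Qed.

Lemma normc_distC z y : normc (z - y) = normc (y - z).
Proof. by rewrite -normcN opprB. Qed.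

Lemma normc_real (c : R) : normc (real_complex R c) = `|c|.
Proof. by rewrite /= expr0n/= addr0 sqrtr_sqr. Qed.

Lemma normc_sum (I : Type) (r : seq I) (F : I -> Cx R) :
  normc (\sum_(i <- r) F i) <= \sum_(i <- r) normc (F i).
Proof.
elim/big_ind2: _ => [|x y z t xy zt|//]; first by rewrite ComplexField.Normc.normc0.
by rewrite (le_trans (normcD _ _))// lerD.
Qed.

End ComplexParts.

Section ComplexBoundedMeasurable.
Context {R : realType} {d0 : measure_display} {T : measurableType d0}.
Variable Om : set T.
Implicit Types f g : T -> Cx R.

Definition cbmeas f := forall b, bmeas Om (fun x => cpart b (f x)).

Lemma cbmeas_sum (I : Type) (r : seq I) (F : I -> T -> Cx R) :
  (forall i, cbmeas (F i)) -> cbmeas (fun x => \sum_(i <- r) F i x).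
Proof.
move=> bF b; rewrite (_ : (fun _ => _) = fun x => \sum_(i <- r) cpart b (F i x)).
  by apply: bmeas_sum => i; exact: bF.
by apply/funext => x; rewrite cpart_sum.
Qed.

Lemma cbmeasZ (c : Cx R) f : cbmeas f -> cbmeas (fun x => c * f x).
Proof.
move=> bf b; case: c => u v.
pose h x := (if b then v else u) * cpart false (f x) +
            (if b then u else - v) * cpart true (f x).
rewrite (_ : (fun _ => _) = h).
  by apply: bmeasD; apply: bmeasZ; exact: bf.
by apply/funext => x; rewrite /h {h}; case: (f x) => ? ?; case: b => /=; ring.
Qed.

Lemma cbmeasB f g : cbmeas f -> cbmeas g -> cbmeas (fun x => f x - g x).
Proof.
move=> bf bg b; rewrite (_ : (fun _ => _) = fun x => cpart b (f x) - cpart b (g x)).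
  by apply: bmeasB; [exact: bf|exact: bg].
by apply/funext => x; rewrite cpartB.
Qed.

Lemma bmeas_normc f : cbmeas f -> bmeas Om (fun x => normc (f x)).
Proof.
move=> bf; rewrite (_ : (fun _ => _) = fun x => `|cpart false (f x) * cpart false (f x) +
  cpart true (f x) * cpart true (f x)| `^ 2^-1).
  by apply: bmeas_powR => //; apply: bmeasD; apply: bmeasM; exact: bf.
apply/funext => x; rewrite -!expr2 -sqr_normc_cpart powR12_sqrt//.
by rewrite ger0_norm ?sqr_ge0// sqrtr_sqr ger0_norm// normc_ge0.
Qed.

Lemma bmeas_normc_sqr f : cbmeas f -> bmeas Om (fun x => normc (f x) ^+ 2).
Proof.
move=> /bmeas_normc bf; rewrite (_ : (fun _ => _) = fun x => normc (f x) * normc (f x)).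
  exact: bmeasM.
by apply/funext => x; rewrite expr2.
Qed.

Lemma bmeas_normc_powR (q : R) f : 0 <= q -> cbmeas f ->
  bmeas Om (fun x => normc (f x) `^ q).
Proof.
move=> q0 /bmeas_normc bf; rewrite (_ : (fun _ => _) = fun x => `|normc (f x)| `^ q).
  exact: bmeas_powR.
by apply/funext => x; rewrite ger0_norm// normc_ge0.
Qed.

End ComplexBoundedMeasurable.

(** * Combinations as means over a signed dictionary *)

Section SignedDictionary.
Context {R : realType} {d0 : measure_display} {T : measurableType d0}.
Variables (Om : set T) (I : finType) (psi : I -> T -> Cx R).
Hypothesis psi_bmeas : forall k, cbmeas Om (psi k).
Hypothesis psi_le1 : forall k x, Om x -> normc (psi k x) <= 1.

(* [Some (k, c, t)] stands for [(-1)^t i^c psi_k], and [None] for [0]. *)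
Definition signed_unit (c t : bool) : Cx R :=
  if c then Complex 0 ((-1) ^+ t) else Complex ((-1) ^+ t) 0.

Definition signed_elt (j : option (I * bool * bool)) (x : T) : Cx R :=
  if j is Some (k, c, t) then signed_unit c t * psi k x else 0.

Lemma normc_signed_unit c t : normc (signed_unit c t) = 1.
Proof. by case: c; rewrite /= sqrr_sign expr0n/= ?addr0 ?add0r sqrtr1. Qed.

Lemma cbmeas_signed_elt j : cbmeas Om (signed_elt j).
Proof.
case: j => [[[k c] t]|]; first exact: cbmeasZ.
by move=> b; rewrite (_ : (fun _ => _) = fun=> 0); [exact: bmeas_cst|
  apply/funext => x; case: b].
Qed.

Lemma normc_signed_elt j x : Om x -> normc (signed_elt j x) <= 1.
Proof.
case: j => [[[k c] t]|] Ox /=; last by rewrite expr0n/= addr0 sqrtr0.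
rewrite -[X in X <= _]/(normc (signed_unit c t * psi k x)).
by rewrite ComplexField.Normc.normcM normc_signed_unit mul1r psi_le1.
Qed.

Definition comb (a : I -> Cx R) x := \sum_k a k * psi k x.

Definition coef_norm (a : I -> Cx R) := \sum_k \sum_(c : bool) `|cpart c (a k)|.

Lemma cbmeas_comb a : cbmeas Om (comb a).
Proof. by apply: cbmeas_sum => k; exact: cbmeasZ. Qed.

Lemma normc_comb_le a x : Om x -> normc (comb a x) <= coef_norm a.
Proof.
move=> Ox; apply: le_trans (normc_sum _ _) _; apply: ler_sum => k _.
rewrite ComplexField.Normc.normcM (le_trans _ (normc_le_cpart _))//.
by rewrite ler_piMr ?normc_ge0 ?psi_le1.
Qed.

(** [Some (k, c, t)] receives the positive ([t = false]) or negative ([t = true]) part of the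
    coordinate [c] of [a k], divided by [A]. The leftover mass sits on the zero element, which makes
    [comb a / A] a genuine mean. *)
Definition signed_weight (A : R) (a : I -> Cx R) (j : option (I * bool * bool)) : R :=
  if j is Some (k, c, t) then
    (`|cpart c (a k)| + (-1) ^+ t * cpart c (a k)) / (2 * A)
  else 1 - coef_norm a / A.

Lemma big_option_triple (F : option (I * bool * bool) -> R) :
  \sum_j F j = F None +
    \sum_k \sum_(c : bool) \sum_(t : bool) F (Some (k, c, t)).
Proof.
rewrite (bigD1 None)//=; congr (_ + _).
rewrite pair_bigA/= pair_bigA/=.
rewrite (reindex_omap Some id) => [|[[[k c] t]|]//].
by apply: eq_big => [[[k c] t]|[[k c] t] _] //=; rewrite eqxx.
Qed.

Section Weights.
Variables (A : R) (a : I -> Cx R).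
Hypotheses (A_gt0 : 0 < A) (aA : coef_norm a <= A).

Lemma signed_weight_ge0 j : 0 <= signed_weight A a j.
Proof.
case: j => [[[k c] t]|] /=; last by rewrite subr_ge0 ler_pdivrMr ?mul1r.
rewrite divr_ge0//; last by rewrite mulr_ge0// ltW.
set y := cpart c (a k); have := ler_norm y; have := ler_norm (- y).
by rewrite normrN; case: t => /=; rewrite ?expr1 ?expr0; lra.
Qed.

Lemma signed_weight_sum1 : \sum_j signed_weight A a j = 1.
Proof.
rewrite big_option_triple/= [X in _ + X](_ : _ = coef_norm a / A) ?subrK//.
rewrite /coef_norm mulr_suml; apply: eq_bigr => k _.
rewrite mulr_suml; apply: eq_bigr => c _.
by rewrite big_bool/= expr1 expr0; field; rewrite gt_eqF.
Qed.

Lemma signed_weight_mean b x :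
  wmean (fun b j x => cpart b (signed_elt j x)) (signed_weight A a) b x =
  cpart b (comb a x) / A.
Proof.
rewrite /wmean big_option_triple/= [X in _ * X](_ : _ = 0); last by case: b.
rewrite mulr0 add0r /comb cpart_sum mulr_suml; apply: eq_bigr => k _.
rewrite big_bool/= !big_bool/= expr1 expr0.
case: (a k) (psi k x) => u v [y z]; case: b => /=; field; by rewrite gt_eqF.
Qed.

Definition signed_average (s : seq (option (I * bool * bool))) x : Cx R :=
  real_complex R (A / (size s)%:R) * \sum_(j <- s) signed_elt j x.

Lemma cbmeas_signed_average s : cbmeas Om (signed_average s).
Proof. by apply: cbmeasZ; apply: cbmeas_sum => j; exact: cbmeas_signed_elt. Qed.

Lemma signed_average_dev s x : (0 < size s)%N ->
  normc (signed_average s x - comb a x) <= A / (size s)%:R *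
    \sum_(b : bool) `|deviation (fun b j x => cpart b (signed_elt j x))
                        (signed_weight A a) b s x|.
Proof.
move=> s0; have s0' : (size s)%:R != 0 :> R by rewrite pnatr_eq0 -lt0n.
apply: le_trans (normc_le_cpart _) _; rewrite mulr_sumr; apply: ler_sum => b _.
rewrite -[X in X * `|_|]ger0_norm ?divr_ge0 ?(ltW A_gt0)// -normrM.
rewrite cpartB /signed_average cpartZ cpart_sum /deviation sumrB.
rewrite signed_weight_mean big_const_seq count_predT iter_addr_0.
rewrite (_ : A / (size s)%:R * (_ - _) = A / (size s)%:R * \sum_(i <- s) cpart b (signed_elt i x) - cpart b (comb a x))//.
by field; rewrite s0' gt_eqF.
Qed.

End Weights.
End SignedDictionary.

(** * Discretization of the L_2 norm *)

Section DyadicLevels.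
Context {R : realType}.
Implicit Types y z : R.

Lemma sum_pow4 n : \sum_(i < n) (4 : R) ^+ i = (4 ^+ n - 1) / 3.
Proof.
elim: n => [|n IHn]; first by rewrite big_ord0 expr0 subrr mul0r.
by rewrite big_ord_recr/= IHn exprS; field.
Qed.

Lemma pow4E n : (4 : R) ^+ n = (2 ^+ n) ^+ 2.
Proof. by rewrite -exprM mulnC exprM (_ : 2 ^+ 2 = 4)// expr2; lra. Qed.

(** Values up to 1/2 are paid for by 1/4; for a larger y, the level with 2^i / 2 <= y <= 2^i alone
    contributes 4^i >= y^2. *)
Lemma sqr_le_levels L y : 0 <= y <= 2 ^+ L ->
  y ^+ 2 <= 4^-1 + \sum_(i < L.+1) 4 ^+ i * (2 ^+ i / 2 <= y)%R%:R.
Proof.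
move=> /andP[y0]; elim: L => [|L IHL] yL.
  rewrite big_ord1 expr0 mul1r; rewrite expr0 in yL.
  have [y2|y2] := leP (1 / 2) y.
    have : y ^+ 2 <= 1 by rewrite expr_le1.
    by rewrite mulr1n; lra.
  rewrite mulr0n addr0; have : y ^+ 2 <= 2^-1 ^+ 2.
    by rewrite ler_pXn2r ?nnegrE//; lra.
  by rewrite exprVn (_ : 2 ^+ 2 = 4)// expr2; lra.
rewrite big_ord_recr/=; have [yL'|yL'] := leP y (2 ^+ L).
  by rewrite addrA ler_wpDr ?IHL// mulr_ge0// exprn_ge0.
rewrite (_ : 2 ^+ L.+1 / 2 = 2 ^+ L :> R); last by rewrite exprS; field.
rewrite (ltW yL') mulr1 addrA ler_wpDl//.
  by rewrite addr_ge0 ?invr_ge0// sumr_ge0// => i _; rewrite mulr_ge0// exprn_ge0.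
by rewrite pow4E ler_pXn2r// nnegrE exprn_ge0.
Qed.

(** The active levels form a geometric sum, at most 4/3 of its largest term. *)
Lemma levels_le_sqr n z : 0 <= z ->
  \sum_(i < n) 4 ^+ i * (2 ^+ i <= z)%R%:R <= 4 / 3 * z ^+ 2.
Proof.
move=> z0; elim: n => [|n IHn].
  by rewrite big_ord0 mulr_ge0 ?sqr_ge0.
have [nz|nz] := leP (2 ^+ n) z; last first.
  by rewrite big_ord_recr/= [(2 ^+ n <= z)%R]leNgt nz mulr0 addr0.
apply: (@le_trans _ _ (\sum_(i < n.+1) 4 ^+ i)).
  by apply: ler_sum => i _; rewrite ler_piMr ?exprn_ge0// lern1 leq_b1.
rewrite sum_pow4; have : (2 ^+ n) ^+ 2 <= z ^+ 2.
  by rewrite ler_pXn2r// nnegrE exprn_ge0.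
by rewrite -pow4E (exprS _ n); lra.
Qed.

End DyadicLevels.

Section Discretization.
Context {R : realType} {d0 : measure_display} {T : measurableType d0}.
Variables (Om : set T) (mu : {measure set T -> \bar R}).
Hypotheses (mOm : measurable Om) (muOm : mu Om = 1%E).
Variables (I : finType) (psi : I -> T -> Cx R).
Hypothesis psi_bmeas : forall k, cbmeas Om (psi k).
Hypothesis psi_le1 : forall k x, Om x -> normc (psi k x) <= 1.
Variables (s Lam : R) (L m : nat).
Hypotheses (s_gt0 : 0 < s) (sL : s <= 4 ^+ L) (Ls : 4 ^+ L <= 4 * s).
Hypothesis m_gt0 : (0 < m)%N.

Let A := Num.sqrt s.
Let J : finType := option (I * bool * bool).
(** If both parts deviate by at most [rho i] per draw, the rescaled average is off by at most 2 A
    rho = 2^i / 8. *)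
Let rho (i : nat) : R := 2 ^+ i / (16 * A).

(** Enough draws for n rho^2 / 32 >= Lam, so that the exceptional set of the tail bound has size of
    order e^-Lam. *)
Definition level_size (i : nat) : nat := (Num.trunc (16 * 16 * 32 * s * Lam / 4 ^+ i)).+1.

(** The additive error of [select_points] for a set of weight [netw]. *)
Definition level_slack (i : nat) : R :=
  2 * (ln 2 + (ln L.+1%:R + (level_size i)%:R * ln (#|J|)%:R)) / m%:R.

Let net : finType := {i : 'I_L.+1 & (level_size i).-tuple J}.

(** The cut 3/8 lies midway between the heights 1/2 and 1/4 (in units of 2^i), which leaves the
    approximation error 2^i / 8 as margin on either side. *)
Let netB (p : net) (x : T) : R :=
  (3 * 2 ^+ tag p / 8 <= normc (signed_average psi A (tagged p) x))%R%:R.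

Let netw (p : net) : R := (L.+1%:R * (#|J|)%:R ^+ level_size (tag p))^-1.

Let A_gt0 : 0 < A. Proof. by rewrite sqrtr_gt0. Qed.

Let cardJ_gt0 : (0 : R) < (#|J|)%:R.
Proof. by rewrite ltr0n; apply/card_gt0P; exists None. Qed.

Let netw_gt0 p : 0 < netw p.
Proof. by rewrite invr_gt0 mulr_gt0 ?ltr0n// exprn_gt0. Qed.

Let netw_sum : \sum_p netw p <= 1.
Proof.
rewrite -(@sig_big_dep _ _ _ 'I_L.+1 (fun i => (level_size i).-tuple J) xpredT
  (fun _ => xpredT) (fun i _ => (L.+1%:R * (#|J|)%:R ^+ level_size i)^-1))/=.
under eq_bigr => i _.
  rewrite sumr_const card_tuple -[_ *+ _]mulr_natr natrX invfM mulfVK.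
    over.
  by rewrite expf_neq0// gt_eqF.
by rewrite sumr_const card_ord -[_ *+ _]mulr_natr mulVf// pnatr_eq0.
Qed.

Let lnNnetw p : ln 2 - ln (netw p) =
  ln 2 + (ln L.+1%:R + (level_size (tag p))%:R * ln (#|J|)%:R).
Proof.
rewrite /netw lnV ?posrE ?mulr_gt0 ?ltr0n ?exprn_gt0// opprK.
rewrite lnM ?posrE ?ltr0n ?exprn_gt0// lnXn// mulr_natl//.
Qed.

Let A_sqr : A ^+ 2 = s. Proof. by rewrite sqr_sqrtr// ltW. Qed.

Let rho_bounds (i : 'I_L.+1) : 0 <= rho i <= 4.
Proof.
rewrite /rho divr_ge0 ?exprn_ge0 ?mulr_ge0 ?(ltW A_gt0)//=.
rewrite ler_pdivrMr ?mulr_gt0//.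
have iL : (2 : R) ^+ i <= 2 ^+ L by rewrite ler_eXn2l// ?ltr1n// -ltnS.
have L2 : (2 : R) ^+ L <= 2 * A.
  rewrite -(@ler_pXn2r _ 2)// ?nnegrE ?exprn_ge0 ?mulr_ge0 ?(ltW A_gt0)//.
  by rewrite -pow4E exprMn A_sqr (_ : 2 ^+ 2 = 4)// expr2; lra.
by have := A_gt0; lra.
Qed.

Let level_size_large i : Lam <= (level_size i)%:R * rho i ^+ 2 / 32.
Proof.
have p4 : (0 : R) < 4 ^+ i by rewrite exprn_gt0.
have : 16 * 16 * 32 * s * Lam / 4 ^+ i <= (level_size i)%:R.
  by rewrite ltW// /level_size truncnS_gt.
rewrite ler_pdivrMr// => h.
have -> : (level_size i)%:R * rho i ^+ 2 / 32 =
          (level_size i)%:R * 4 ^+ i / (16 * 16 * 32 * s).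
  rewrite /rho expr_div_n exprMn A_sqr -pow4E; field.
  by rewrite gt_eqF.
by rewrite ler_pdivlMr ?mulr_gt0// mulrC.
Qed.

(* At level i, functions of coefficient norm at most sqrt s are replaced, off a
   set that is small both for mu and for the sample, by averages of
   [level_size i] signed dictionary elements, of which there are finitely many. *)
Lemma exists_discretization :
  16 * expR (- Lam) * \sum_(i < L.+1) 4 ^+ i <= 8^-1 ->
  \sum_(i < L.+1) 4 ^+ i * level_slack i <= 8^-1 ->
  exists xi : seq T, [/\ size xi = m, forall x, x \in xi -> Om x &
  forall a : I -> Cx R, coef_norm a <= A ->
    \int[mu]_(x in Om) (normc (comb psi a x) ^+ 2) = 1 ->
    1 <= 88 * average xi (fun x => normc (comb psi a x) ^+ 2)].
Proof.
move=> cond1 cond2.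
have netB_bmeas p : bmeas Om (netB p).
  by apply: bmeas_geb; apply: bmeas_normc; exact: cbmeas_signed_average.
have netB01 p x : netB p x = 0 \/ netB p x = 1.
  by rewrite /netB; case: (_ <= _)%R; [right|left].
have [xi [sxi Oxi xiP]] := select_points mOm muOm netw_gt0 netw_sum
  netB_bmeas netB01 m_gt0.
exists xi; split => // a aA a1.
set u := comb psi a in a1 *.
have bu : cbmeas Om u by exact: cbmeas_comb.
have bnu := bmeas_normc bu; have bnu2 := bmeas_normc_sqr bu.
have hmu := Rintegral_pos_linear mOm muOm.
have hav := @average_pos_linear R _ _ _ _ Oxi.
have hnu := pos_linearD hmu hav.
have [muD muZ mule] := hmu; have [avD avZ avle] := hav.
set Im := fun f : T -> R => \int[mu]_(x in Om) f x in hmu muD muZ mule *.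
have uA x : Om x -> normc (u x) <= A.
  by move=> Ox; apply: le_trans aA; exact: (normc_comb_le psi_le1).
have bG (c : R) : bmeas Om (fun x => (c <= normc (u x))%R%:R : R) by exact: (bmeas_geb c bnu).
have level (i : 'I_L.+1) : Im (fun x => (2 ^+ i / 2 <= normc (u x))%R%:R) <=
    2 * average xi (fun x => (2 ^+ i / 4 <= normc (u x))%R%:R) +
    level_slack i + 16 * expR (- Lam).
  pose phi b j x := cpart b (signed_elt psi j x).
  have phib b j : bmeas Om (phi b j) by exact: (cbmeas_signed_elt psi_bmeas).
  have phi1 b j x : Om x -> `|phi b j x| <= 1.
    move=> Ox; apply: le_trans (cpart_le_normc _ _) _.
    exact: (normc_signed_elt psi_le1).
  (* [c] depends on [xi] through the functional. There is no circularity: [xi] was chosen beforehand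
     for all tuples of the net. *)
  have [c sc] := maurey_tail hnu (signed_weight_ge0 A_gt0 aA)
    (signed_weight_sum1 a A_gt0) phib phi1 (level_size i) (rho_bounds i).
  set bad := (fun x => \sum_b _).
  have bbad : bmeas Om bad.
    apply: bmeas_sum => b; apply: bmeas_geb; apply: bmeas_normr.
    exact: bmeas_deviation.
  rewrite -/(Im _) -/(Im _) => badle.
  have av0 : 0 <= average xi bad.
    by apply: (pos_linear_ge0 hav) => // x _; rewrite sumr_ge0.
  have mu0 : 0 <= Im bad.
    by apply: (pos_linear_ge0 hmu) => // x _; rewrite sumr_ge0.
  (* The functional has total mass 2, hence 4 * 2. *)
  have bad8 : Im bad + average xi bad <= 8 * expR (- Lam).
    apply: le_trans badle _; rewrite average_cst1 ?sxi// [Im _]Rintegral_cst1//.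
    have : expR (- ((level_size i)%:R * rho i ^+ 2 / 32)) <= expR (- Lam).
      by rewrite ler_expR lerN2 level_size_large.
    by lra.
  have scP : size c == level_size i by rewrite sc.
  pose p : net := Tagged (fun i : 'I_L.+1 => (level_size i).-tuple J) (Tuple scP).
  have := xiP p; rewrite lnNnetw -/(level_slack _) -/(Im _) => Bp.
  have near x : Om x -> bad x < 1 ->
      normc (signed_average psi A c x - u x) < 2 ^+ i / 8.
    move=> Ox bad1.
    have dev b : `|deviation phi (signed_weight A a) b c x| < (level_size i)%:R * rho i.
      rewrite ltNge; apply/negP => h; move: bad1; rewrite ltNge => /negP; apply.
      rewrite /bad (bigD1 b)//= h lerDl sumr_ge0//.
    have c0 : (0 < size c)%N by rewrite sc.
    apply: le_lt_trans (signed_average_dev psi a A_gt0 x c0) _.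
    rewrite sc big_bool/= mulrC -ltr_pdivlMr; last first.
      by rewrite divr_gt0// ltr0n.
    have := dev true; have := dev false.
    rewrite (_ : 2 ^+ i / 8 / _ = 2 * ((level_size i)%:R * rho i)); first by lra.
    by rewrite /rho; field; rewrite gt_eqF//= pnatr_eq0.
  have bad_small x : ~~ (bad x < 1) -> 1 <= bad x by rewrite -leNgt.
  have bad_ge0 x : 0 <= bad x by rewrite sumr_ge0.
  have step1 : Im (fun x => (2 ^+ i / 2 <= normc (u x))%R%:R) <=
      Im (netB p) + Im bad.
    rewrite -muD//; apply: mule => [//||x Ox]; first exact: bmeasD.
    have [h|] := leP (2 ^+ i / 2) (normc (u x)); last first.
      by move=> _; rewrite addr_ge0// /netB ler0n.
    have [bad1|/bad_small bad1] := boolP (bad x < 1); last first.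
      by rewrite ler_wpDl// /netB ler0n.
    rewrite /netB /=.
    have [_|gx] := leP (3 * 2 ^+ i / 8) (normc (signed_average psi A c x)).
      by rewrite ler_wpDr.
    have := near x Ox bad1; rewrite ltNge => /negP[].
    have := normcB (signed_average psi A c x - u x) (signed_average psi A c x).
    rewrite [X in X - _]addrC addrK normcN. lra.
  have step2 : average xi (netB p) <=
      average xi (fun x => (2 ^+ i / 4 <= normc (u x))%R%:R) + average xi bad.
    rewrite -avD//; apply: avle => [//||x Ox]; first exact: bmeasD.
    have [h|] := leP (2 ^+ i / 4) (normc (u x)).
      by rewrite /netB ler_wpDr// lern1 leq_b1.
    have [bad1|/bad_small bad1] := boolP (bad x < 1); last first.
      by move=> _; rewrite add0r (le_trans _ bad1)// /netB lern1 leq_b1.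
    rewrite /netB /= => ux.
    have [gx|_] := leP (3 * 2 ^+ i / 8) (normc (signed_average psi A c x)); last first.
      by rewrite add0r.
    have := near x Ox bad1; rewrite ltNge => /negP[].
    have := normcD (signed_average psi A c x - u x) (u x).
    by rewrite subrK; lra.
  rewrite /level_slack in Bp *; lra.
(* As |u| <= A, the L + 1 levels exhaust the values of u. *)
have A2L : A <= 2 ^+ L.
  by rewrite -(@ler_pXn2r _ 2)// ?nnegrE ?exprn_ge0 ?(ltW A_gt0)// A_sqr -pow4E.
have up : 1 <= 4^-1 + \sum_(i < L.+1) 4 ^+ i *
    Im (fun x => (2 ^+ i / 2 <= normc (u x))%R%:R).
  rewrite -[leLHS]a1 (_ : 4^-1 + _ = Im (fun x => 4^-1 + \sum_(i < L.+1) 4 ^+ i *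
      (2 ^+ i / 2 <= normc (u x))%R%:R)).
    apply: mule => // [|x Ox].
      by apply: bmeasD; [exact: bmeas_cst|apply: bmeas_sum => i; exact: bmeasZ].
    by apply: sqr_le_levels; rewrite normc_ge0 (le_trans (uA x Ox)).
  have bS : bmeas Om (fun x => \sum_(i < L.+1) 4 ^+ i *
      (2 ^+ i / 2 <= normc (u x))%R%:R : R) by apply: bmeas_sum => i; exact: bmeasZ.
  rewrite /Im (muD _ _ (bmeas_cst _ _) bS) -/(Im _) -/(Im _).
  rewrite (pos_linear_cst hmu) [Im (fun=> 1)]Rintegral_cst1// mulr1; congr (_ + _).
  rewrite (pos_linear_sum hmu) => [|i]; last exact: bmeasZ.
  by apply: eq_bigr => i _; rewrite /Im muZ.
have lo : \sum_(i < L.+1) 4 ^+ i *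
    average xi (fun x => (2 ^+ i / 4 <= normc (u x))%R%:R) <=
    22 * average xi (fun x => normc (u x) ^+ 2).
  rewrite -avZ//; apply: (@le_trans _ _ (average xi (fun x =>
      \sum_(i < L.+1) 4 ^+ i * (2 ^+ i / 4 <= normc (u x))%R%:R))).
    rewrite (pos_linear_sum hav) => [|i]; last exact: bmeasZ.
    by rewrite ler_sum// => i _; rewrite avZ.
  apply: avle => [||x Ox]; first by apply: bmeas_sum => i; exact: bmeasZ.
    exact: bmeasZ.
  have n0 := normc_ge0 (u x).
  (* Height 2^i / 4 for |u| is height 2^i for 4 |u|, and 16 * 4/3 <= 22. *)
  have := @levels_le_sqr _ L.+1 (4 * normc (u x)) (mulr_ge0 (ler0n _ 4) n0).
  under eq_bigr do rewrite -ler_pdivrMl// [4^-1 * _]mulrC.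
  have := sqr_ge0 (normc (u x)); rewrite exprMn (_ : 4 ^+ 2 = 16)//; first by lra.
  by rewrite expr2; lra.
have mid : \sum_(i < L.+1) 4 ^+ i * Im (fun x => (2 ^+ i / 2 <= normc (u x))%R%:R) <=
   2 * \sum_(i < L.+1) 4 ^+ i *
    average xi (fun x => (2 ^+ i / 4 <= normc (u x))%R%:R) +
   \sum_(i < L.+1) 4 ^+ i * level_slack i +
   16 * expR (- Lam) * \sum_(i < L.+1) 4 ^+ i.
  rewrite !mulr_sumr -!big_split/=; apply: ler_sum => i _.
  have p4 : (0 : R) <= 4 ^+ i by rewrite exprn_ge0.
  apply: le_trans (ler_wpM2l p4 (level i)) _.
  by rewrite le_eqVlt; apply/orP; left; apply/eqP; ring.
(* In total 1 <= 1/4 + 2 * 22 * average + 1/8 + 1/8, whence the constant 88. *)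
lra.
Qed.

End Discretization.

(** * Integrals and L_p norms *)

Section IntegralMonotone.
Context {R : realType} {d0 : measure_display} {T : measurableType d0}.
Variables (mu : {measure set T -> \bar R}) (Om : set T).

(* The integral of a nonnegative function is a supremum over the simple functions
   below it. *)
Lemma le_integral_nonmeasurable (f g : T -> \bar R) :
  (forall x, Om x -> 0 <= f x)%E -> (forall x, Om x -> f x <= g x)%E ->
  (\int[mu]_(x in Om) f x <= \int[mu]_(x in Om) g x)%E.
Proof.
move=> f0 fg; rewrite integral_mkcond [leRHS]integral_mkcond.
rewrite !ge0_integralTE; first last.
- by apply: erestrict_ge0 => x Ox; exact: f0.
- by apply: erestrict_ge0 => x Ox; exact: le_trans (f0 x Ox) (fg x Ox).
apply: le_ereal_sup => _ [h hf <-]; exists h => // x.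
by apply: le_trans (hf x) _; apply: lee_restrict.
Qed.

End IntegralMonotone.

Section LpNorms.
Context {R : realType} {d : nat}.
Variables (Om : set (Rd R d)) (mu : {measure set (Rd R d) -> \bar R}).
Hypotheses (mOm : measurable Om) (muOm : mu Om = 1%E).

Lemma within_continuous_bmeas (f : 'rV[R]_d -> R) (M : R) :
  {within (Om : set 'rV[R]_d), continuous f} ->
  (forall x, Om x -> `|f x| <= M) -> bmeas Om f.
Proof.
move=> /continuousP cf fM; split; last by exists M.
apply: (measurability _ (RGenOpens.measurableE R)).
move=> _ [_ [a [b ->] <-]].
have oab : open (`]a, b[%classic : set R) by exact: interval_open.
have /open_subspaceP [V oV VE] := cf _ oab.
rewrite setIC (_ : _ `&` _ = (V : set (Rd R d)) `&` Om).
  by apply: measurableI => //; exact: sub_sigma_algebra.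
by rewrite VE.
Qed.

Lemma CLpnormE (q : R) (u : 'rV[R]_d -> Cx R) : 0 < q -> cbmeas Om u ->
  CLpnorm mu Om q u =
  ((\int[mu]_(x in Om) (normc (u x) `^ q)) `^ q^-1)%:E.
Proof.
move=> q0 bu; rewrite /CLpnorm (integral_bmeasE mOm muOm) ?poweR_EFin//.
exact: (bmeas_normc_powR (ltW q0) bu).
Qed.

Lemma Rintegral_powR_ge0 (q : R) (u : 'rV[R]_d -> Cx R) :
  0 <= \int[mu]_(x in Om) (normc (u x) `^ q).
Proof. by apply: Rintegral_ge0 => x _; exact: powR_ge0. Qed.

(** [f] will be the recovery error of a member of the class, known only through a pointwise
    majorant; measurability is asked of the majorant. *)
Lemma CLpnorm_le (q B : R) (f : 'rV[R]_d -> Cx R) (g : 'rV[R]_d -> R) :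
  0 < q -> 0 <= B -> bmeas Om (fun x => `|g x| `^ q) ->
  (forall x, Om x -> normc (f x) <= g x) ->
  \int[mu]_(x in Om) (`|g x| `^ q) <= B `^ q ->
  (CLpnorm mu Om q f <= B%:E)%E.
Proof.
move=> q0 B0 bg fg gB.
have H : (\int[mu]_(x in Om) (normc (f x) `^ q)%:E <= (B `^ q)%:E)%E.
  apply: (@le_trans _ _ (\int[mu]_(x in Om) (`|g x| `^ q)%:E)%E).
    apply: le_integral_nonmeasurable => x Ox; first by rewrite lee_fin powR_ge0.
    rewrite lee_fin ge0_ler_powR ?nnegrE ?normc_ge0 ?(ltW q0)//.
    by rewrite (le_trans (fg x Ox))// ler_norm.
  by rewrite (integral_bmeasE mOm muOm)// lee_fin.
rewrite /CLpnorm; set X := (\int[mu]_(x in Om) _)%E in H *.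
have X0 : (0 <= X)%E by apply: integral_ge0 => x _; rewrite lee_fin powR_ge0.
move: H X0; case: X => [y|//|//] yB y0; rewrite poweR_EFin lee_fin.
rewrite lee_fin in yB; rewrite lee_fin in y0.
have -> : B = (B `^ q) `^ q^-1 by rewrite -powRrM mulfV ?gt_eqF// powRr1.
by rewrite ge0_ler_powR ?nnegrE ?powR_ge0 ?invr_ge0 ?(ltW q0).
Qed.

Lemma Rintegral_powR2 (u : 'rV[R]_d -> Cx R) :
  \int[mu]_(x in Om) (normc (u x) `^ 2) = \int[mu]_(x in Om) (normc (u x) ^+ 2).
Proof. by apply: eq_Rintegral => x _; rewrite powR_mulrn// normc_ge0. Qed.

Lemma CLpnorm2_sqrE (u : 'rV[R]_d -> Cx R) : cbmeas Om u ->
  (CLpnorm mu Om 2 u * CLpnorm mu Om 2 u)%E =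
  (\int[mu]_(x in Om) (normc (u x) ^+ 2))%:E.
Proof.
move=> bu; rewrite CLpnormE// -EFinM -Rintegral_powR2; congr (_%:E).
rewrite -expr2 -powR_mulrn ?powR_ge0// -powRrM mulVf// powRr1//.
exact: Rintegral_powR_ge0.
Qed.

(* The constant 1/2 comes from y^2 <= t^2 (y^p / t^p + 1), which stands in for
   Jensen's inequality. *)
Lemma reverse_Lp_constant_ge_half (p H : R) (u : 'rV[R]_d -> Cx R) :
  2 <= p -> cbmeas Om u -> 0 < \int[mu]_(x in Om) (normc (u x) ^+ 2) ->
  (CLpnorm mu Om p u <= H%:E * CLpnorm mu Om 2 u)%E -> 2^-1 <= H.
Proof.
move=> p2 bu U0; have p0 : 0 < p by lra.
rewrite !CLpnormE// -EFinM lee_fin Rintegral_powR2.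
set U := \int[mu]_(x in Om) (normc (u x) ^+ 2) in U0 *.
set P := \int[mu]_(x in Om) (normc (u x) `^ p).
have P0 : 0 <= P by exact: Rintegral_powR_ge0.
rewrite powR12_sqrt ?(ltW U0)// => PH; rewrite leNgt; apply/negP => H2.
set V := Num.sqrt U in PH; have V0 : 0 < V by rewrite sqrtr_gt0.
have V2 : V ^+ 2 = U by rewrite sqr_sqrtr// ltW.
(* If H < 1/2 then P <= t^p, and integrating the inequality gives U <= 2 t^2 = U / 2. *)
have [t tE] : {t | t = V / 2} by eexists.
have t0 : 0 < t by rewrite tE; lra.
have PV : P <= t `^ p.
  have -> : P = (P `^ p^-1) `^ p by rewrite -powRrM mulVf ?gt_eqF// powRr1.
  rewrite ge0_ler_powR ?nnegrE ?powR_ge0 ?(ltW p0) ?(ltW t0)//.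
  apply: le_trans PH _; rewrite tE mulrC ler_wpM2l ?(ltW V0)//; exact: ltW.
have tp0 : 0 < t `^ p by rewrite powR_gt0.
have [ID IZ Ile] := Rintegral_pos_linear mOm muOm.
have bp := bmeas_normc_powR (ltW p0) bu.
have b2 := bmeas_normc_sqr bu.
have UP : U <= t ^+ 2 * ((t `^ p)^-1 * P + 1).
  have -> : t ^+ 2 * ((t `^ p)^-1 * P + 1) =
     \int[mu]_(x in Om) (t ^+ 2 * ((t `^ p)^-1 * normc (u x) `^ p + 1)).
    rewrite IZ; last by apply: bmeasD; [exact: bmeasZ|exact: bmeas_cst].
    rewrite ID; [|exact: bmeasZ|exact: bmeas_cst].
    by rewrite IZ// Rintegral_cst1.
  apply: Ile => [//||x Ox].
    by apply: bmeasZ; apply: bmeasD; [exact: bmeasZ|exact: bmeas_cst].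
  have y0 := normc_ge0 (u x); set y := normc (u x) in y0 *.
  have [yt|ty] := leP y t.
    rewrite mulrDr mulr1 ler_wpDl//; last by rewrite ler_pXn2r ?nnegrE ?(ltW t0).
    by rewrite mulr_ge0 ?sqr_ge0// mulr_ge0 ?invr_ge0 ?powR_ge0.
  rewrite mulrDr mulr1 ler_wpDr ?sqr_ge0//.
  rewrite mulrA -[leLHS]mulr1 -{1}(@divfK _ (t ^+ 2) _ (y ^+ 2)) ?gt_eqF ?exprn_gt0//.
  rewrite mulr1 [leLHS]mulrC -mulrA ler_wpM2l ?sqr_ge0//.
  rewrite [leRHS]mulrC -expr_div_n -[X in _ <= _ / X]/(t `^ p).
  have -> : y `^ p / t `^ p = (y / t) `^ p.
    have yt0 : 0 <= y / t by rewrite divr_ge0// ltW.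
    by rewrite -{1}(@divfK _ t _ y) ?gt_eqF// (powRM p yt0 (ltW t0)) mulfK// gt_eqF.
  rewrite -powR_mulrn ?divr_ge0 ?(ltW t0)//.
  by apply: ler_powR => //; rewrite ler_pdivlMr// mul1r ltW.
have z1 : (t `^ p)^-1 * P <= 1 by rewrite ler_pdivrMl// mulr1.
move: UP z1; set z := _ * P => UP z1.
have tU : t ^+ 2 = U / 4 by rewrite -V2 tE; field.
have : U * z <= U by rewrite ler_piMr// ltW.
by rewrite tU in UP; lra.
Qed.

End LpNorms.

(** * Dyadic blocks *)

Section Box.
Variable d : nat.
Implicit Types k : 'rV[int]_d.

(** The union of the dyadic blocks j < J. It is empty for J = 0, because half of [2 ^ 0] rounds down
    to 0. *)
Definition box (J : nat) : seq 'rV[int]_d :=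
  undup [seq k <- [seq \row_i (Posz (val (f i)) - Posz (2 ^ J)./2) |
                    f : {ffun 'I_d -> 'I_(2 * (2 ^ J)./2)}] |
         (supnorm k < (2 ^ J)./2)%N].

Lemma box_uniq J : uniq (box J).
Proof. exact: undup_uniq. Qed.

Lemma mem_box J k : (k \in box J) = (supnorm k < (2 ^ J)./2)%N.
Proof.
rewrite mem_undup mem_filter andb_idr// => kM; set M := (2 ^ J)./2 in kM *.
have kiM i : (`|k 0%R i| < M)%N.
  by apply: leq_ltn_trans kM; exact: (leq_bigmax (F := fun i => `|k ord0 i|%N)).
have lt i : (`|(k 0%R i + Posz M)%R| < 2 * M)%N by have := kiM i; lia.
apply/mapP; exists [ffun i => Ordinal (lt i)]; first by rewrite mem_enum.
apply/rowP => i; rewrite mxE ffunE /=; have := kiM i; lia.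
Qed.

Lemma size_box J : (size (box J) <= (2 ^ J) ^ d)%N.
Proof.
apply: leq_trans (size_undup _) _; rewrite size_filter.
apply: leq_trans (count_size _ _) _; rewrite size_map -cardE card_ffun !card_ord.
by case: d => [//|n]; rewrite leq_exp2r// mul2n -[X in (_ <= X)%N]odd_double_half leq_addl.
Qed.

Lemma exists_dyadic_block k : exists j, dyadic_block j k.
Proof.
have ex : exists j, (supnorm k < 2 ^ j)%N by exists (supnorm k); exact: ltn_expl.
case: (ex_minnP ex) => -[|j] lt minj; [exists 0%N|exists j.+1];
  rewrite /dyadic_block lt andbT// expnS mul2n doubleK leqNgt.
by apply/negP => /minj; rewrite ltnn.
Qed.

Lemma dyadic_block_notin_box J j k : k \notin box J -> dyadic_block j k ->
  (J <= j)%N.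
Proof.
rewrite mem_box -leqNgt => kJ /andP[_ kj]; rewrite leqNgt; apply/negP => jJ.
suff : (2 ^ j <= (2 ^ J)./2)%N by lia.
by case: J jJ {kJ} => // J jJ; rewrite expnS mul2n doubleK leq_pexp2l.
Qed.

End Box.

Section TailSums.
Context {R : realType} {d : nat}.
Variables (r beta : R).
Hypotheses (r_gt0 : 0 < r) (beta_gt0 : 0 < beta).
Variable a : 'rV[int]_d -> Cx R.
Hypothesis a_block : forall (j : nat) (Q : seq 'rV[int]_d), uniq Q ->
  all (dyadic_block j) Q ->
  (\sum_(k <- Q) normc (a k) `^ beta) `^ beta^-1 <= 2 `^ (- r * j%:R).

Lemma sum_geometric_tail (q : R) J n : 0 <= q -> q < 1 ->
  \sum_(J <= j < n) q ^+ j <= q ^+ J / (1 - q).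
Proof.
move=> q0 q1; have d1 : 0 < 1 - q by rewrite subr_gt0.
have [nJ|Jn] := leqP n J.
  by rewrite big_geq// divr_ge0 ?exprn_ge0 ?(ltW d1).
rewrite ler_pdivlMr//.
suff -> : (\sum_(J <= j < n) q ^+ j) * (1 - q) = q ^+ J - q ^+ n.
  by rewrite gerBl exprn_ge0.
elim: n Jn => // n IHn; rewrite ltnS leq_eqVlt => /predU1P[<-|Jn].
  by rewrite big_nat1 exprS mulrBr mulr1 mulrC.
by rewrite big_nat_recr ?(ltnW Jn)//= mulrDl IHn// exprS; ring.
Qed.

Lemma block_sum_le j (Q : seq 'rV[int]_d) : uniq Q -> all (dyadic_block j) Q ->
  \sum_(k <- Q) normc (a k) `^ beta <= (2 `^ (- (r * beta))) ^+ j.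
Proof.
move=> uQ bQ; have := a_block uQ bQ; set S := \sum_(k <- Q) _ => SS.
have S0 : 0 <= S by apply: sumr_ge0 => k _; exact: powR_ge0.
have -> : S = (S `^ beta^-1) `^ beta by rewrite -powRrM mulVf ?gt_eqF// powRr1.
apply: le_trans (ge0_ler_powR (ltW beta_gt0) _ _ SS) _; rewrite ?nnegrE ?powR_ge0//.
rewrite -powRrM -powR_mulrn ?powR_ge0// -powRrM.
by rewrite (_ : - r * j%:R * beta = - (r * beta) * j%:R)//; ring.
Qed.

Lemma pow2_lt1 : 2 `^ (- (r * beta)) < 1 :> R.
Proof.
rewrite powRN invf_lt1 ?powR_gt0//.
apply: (@le_lt_trans _ _ (1 `^ (r * beta))); first by rewrite powR1.
by rewrite gt0_ltr_powR ?mulr_gt0 ?nnegrE// ltr1n.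
Qed.

(** Sort [Q] by dyadic blocks: off the box only blocks j >= J occur, and their bounds form a
    geometric series. *)
Lemma tail_sum_le J (Q : seq 'rV[int]_d) : uniq Q ->
  (forall k, k \in Q -> k \notin box d J) ->
  \sum_(k <- Q) normc (a k) `^ beta <=
    (2 `^ (- (r * beta))) ^+ J / (1 - 2 `^ (- (r * beta))).
Proof.
move=> uQ QJ; set q := 2 `^ _.
have [blk blkP] := choice (@exists_dyadic_block d).
pose n := (\max_(k <- Q) blk k).+1.
apply: le_trans (sum_geometric_tail J n (powR_ge0 _ _) pow2_lt1).
apply: (@le_trans _ _ (\sum_(J <= j < n)
    \sum_(k <- [seq k <- Q | dyadic_block j k]) normc (a k) `^ beta)); last first.
  by apply: ler_sum => j _; apply: block_sum_le; rewrite ?filter_uniq// filter_all.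
under [leRHS]eq_bigr do rewrite big_filter big_mkcond.
rewrite exchange_big/= big_seq [leRHS]big_seq; apply: ler_sum => k kQ.
rewrite (bigD1_seq (blk k)) ?iota_uniq//=; last first.
  rewrite mem_index_iota (dyadic_block_notin_box (QJ k kQ) (blkP k))/=.
  by rewrite ltnS; exact: (leq_bigmax_seq (F := blk)).
rewrite blkP lerDl sumr_ge0// => j _; case: ifP => // _; exact: powR_ge0.
Qed.

End TailSums.

(** * Sparse approximation and recovery *)

Section PowRSums.
Context {R : realType}.
Implicit Types x y z q : R.

Lemma powR_homo q x y : 0 <= q -> 0 <= x -> x <= y -> x `^ q <= y `^ q.
Proof. by move=> q0 x0 xy; rewrite ge0_ler_powR// nnegrE// (le_trans x0). Qed.

(** Replacing both terms by the larger one works for exponents below 1 as well as above; both kinds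
    occur. *)
Lemma powRD_le q x y : 0 <= q -> 0 <= x -> 0 <= y ->
  (x + y) `^ q <= 2 `^ q * (x `^ q + y `^ q).
Proof.
move=> q0; wlog xy : x y / x <= y => [W x0 y0|x0 y0].
  by have [xy|/ltW yx] := leP x y; [exact: W|rewrite addrC [X in _ * X]addrC W].
apply: (@le_trans _ _ ((2 * y) `^ q)); first by apply: powR_homo; lra.
by rewrite powRM// ler_wpM2l ?powR_ge0// lerDr powR_ge0.
Qed.

Lemma powRD3_le q x y z : 0 <= q -> 0 <= x -> 0 <= y -> 0 <= z ->
  (x + y + z) `^ q <= 3 `^ q * (x `^ q + y `^ q + z `^ q).
Proof.
move=> q0 x0 y0 z0.
have [t [t0 xt yt zt tq]] : exists t, [/\ 0 <= t, x <= t, y <= t, z <= t &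
    t `^ q <= x `^ q + y `^ q + z `^ q].
  have Px := powR_ge0 x q; have Py := powR_ge0 y q; have Pz := powR_ge0 z q.
  have [xy|yx] := leP x y.
    have [yz|zy] := leP y z; [exists z|exists y]; split; lra.
  have [xz|zx] := leP x z; [exists z|exists x]; split; lra.
apply: (@le_trans _ _ ((3 * t) `^ q)); first by apply: powR_homo; lra.
by rewrite powRM// ler_wpM2l ?powR_ge0.
Qed.

End PowRSums.

Section RestrictedCombinations.
Context {R : realType} {d : nat}.
Variable psi : 'rV[int]_d -> 'rV[R]_d -> Cx R.
Implicit Types (D Q : seq 'rV[int]_d) (c : 'rV[int]_d -> Cx R).

Definition dict D (i : 'I_(size D)) : Rd R d -> Cx R := psi (nth 0 D i).

Definition restrict_coef D Q c (i : 'I_(size D)) : Cx R :=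
  if nth 0 D i \in Q then c (nth 0 D i) else 0.

Lemma big_restrict (V : zmodType) D Q (F : 'rV[int]_d -> V) :
  uniq D -> uniq Q -> {subset Q <= D} ->
  \sum_(i < size D) (if nth 0 D i \in Q then F (nth 0 D i) else 0) =
  \sum_(k <- Q) F k.
Proof.
move=> uD uQ QD.
rewrite -(big_mkord xpredT (fun i => if nth 0 D i \in Q then F (nth 0 D i) else 0)).
rewrite -(big_nth 0 xpredT (fun k => if k \in Q then F k else 0)) -big_mkcond/=.
rewrite -big_filter; apply: perm_big; apply: uniq_perm => //.
  by rewrite filter_uniq.
by move=> k; rewrite mem_filter andb_idr//; exact: QD.
Qed.

Lemma comb_restrict D Q c x : uniq D -> uniq Q -> {subset Q <= D} ->
  comb (dict (D:=D)) (@restrict_coef D Q c) x = lincomb psi Q c x.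
Proof.
move=> uD uQ QD; rewrite /lincomb -(big_restrict _ uD uQ QD).
by apply: eq_bigr => i _; rewrite /restrict_coef; case: ifP => // _; rewrite mul0r.
Qed.

Lemma coef_norm_restrict D Q c : uniq D -> uniq Q -> {subset Q <= D} ->
  coef_norm (@restrict_coef D Q c) <= 2 * \sum_(k <- Q) normc (c k).
Proof.
move=> uD uQ QD; rewrite mulr_sumr -(big_restrict _ uD uQ QD).
apply: ler_sum => i _; rewrite /restrict_coef; case: ifP => _; last first.
  by rewrite big_bool/= normr0 addr0.
by rewrite big_bool mulr_natl mulr2n; apply: lerD; exact: cpart_le_normc.
Qed.

(** Maurey's draws may repeat a frequency or hit a kept one. Merging them gives the duplicate-free
    form that [NI] and the discretization accept. *)
Lemma lincomb_pairs (l : seq ('rV[int]_d * Cx R)) x :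
  \sum_(q <- l) q.2 * psi q.1 x =
  lincomb psi (undup (map fst l)) (fun k => \sum_(q <- l | q.1 == k) q.2) x.
Proof.
rewrite /lincomb; under [RHS]eq_bigr do rewrite mulr_suml big_mkcond.
rewrite exchange_big/= big_seq [RHS]big_seq; apply: eq_bigr => q ql.
rewrite (bigD1_seq q.1) ?undup_uniq//=; last first.
  by rewrite mem_undup; apply/mapP; exists q.
rewrite eqxx big1 ?addr0// => k; rewrite eq_sym => /negbTE kq.
by rewrite kq.
Qed.

Lemma lincomb_filter D (P : pred 'rV[int]_d) c x : lincomb psi D c x =
  lincomb psi [seq k <- D | P k] c x + lincomb psi [seq k <- D | ~~ P k] c x.
Proof. by rewrite /lincomb !big_filter (bigID P). Qed.

End RestrictedCombinations.

Section Sampling.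
Context {R : realType} {d : nat}.
Variables (Om : set (Rd R d)) (mu : {measure set (Rd R d) -> \bar R}).
Hypotheses (mOm : measurable Om) (muOm : mu Om = 1%E).
Variable psi : 'rV[int]_d -> 'rV[R]_d -> Cx R.
Hypothesis psi_bmeas : forall k, cbmeas Om (psi k).
Hypothesis psi_le1 : forall k x, Om x -> normc (psi k x) <= 1.

Lemma cbmeas_lincomb Q c : cbmeas Om (lincomb psi Q c).
Proof. by apply: cbmeas_sum => k; exact: cbmeasZ. Qed.

Lemma lincombZ (z : Cx R) Q c x :
  lincomb psi Q (fun k => z * c k) x = z * lincomb psi Q c x.
Proof. by rewrite /lincomb mulr_sumr; apply: eq_bigr => k _; rewrite mulrA. Qed.

Definition sparse_discretization (D : seq 'rV[int]_d) (u : nat) (xi : seq (Rd R d)) :=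
  forall (Q : seq 'rV[int]_d) (c : 'rV[int]_d -> Cx R), uniq Q ->
    {subset Q <= D} -> (size Q <= u)%N ->
    \int[mu]_(x in Om) (normc (lincomb psi Q c x) ^+ 2) <=
      88 * average xi (fun x => normc (lincomb psi Q c x) ^+ 2).

(** Cauchy-Schwarz over at most 2v terms; the factor 2 on the left pays for the two parts counted by
    [coef_norm]. *)
Lemma bessel_coef_norm (K : R) (v : nat) Q c : 0 < K -> (0 < v)%N ->
  bessel mu Om psi K -> uniq Q -> (size Q <= 2 * v)%N ->
  \int[mu]_(x in Om) (normc (lincomb psi Q c x) ^+ 2) = 1 ->
  2 * \sum_(k <- Q) normc (c k) <= Num.sqrt (8 * v%:R * K).
Proof.
move=> K0 v0 bes uQ sQ I1.
have {bes} := bes Q c uQ; rewrite (CLpnorm2_sqrE mOm muOm); last exact: cbmeas_lincomb.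
rewrite I1 mule1 lee_fin => bes.
have v0' : (0 : R) < v%:R by rewrite ltr0n.
set A := Num.sqrt _.
have A0 : 0 < A by rewrite sqrtr_gt0 !mulr_gt0.
have A2 : A ^+ 2 = 8 * v%:R * K by rewrite sqr_sqrtr// !mulr_ge0// ltW.
(* Cauchy-Schwarz in the form 2y <= y^2 / del + del; this [del] balances the two resulting bounds at
   A / 2 each. *)
pose del := A / (4 * v%:R); have del0 : 0 < del by rewrite divr_gt0// mulr_gt0.
apply: (@le_trans _ _ (\sum_(k <- Q) (normc (c k) ^+ 2 / del + del))).
  rewrite mulr_sumr; apply: ler_sum => k _; set y := normc (c k).
  rewrite -(ler_pM2r del0) [leRHS]mulrDl divfK ?gt_eqF//.
  by have := sqr_ge0 (y - del); rewrite sqrrB !expr2; lra.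
rewrite big_split/= -mulr_suml big_const_seq count_predT iter_addr_0.
have -> : A = K / del + del *+ (2 * v).
  have -> : K = A ^+ 2 / (8 * v%:R) by rewrite A2; field; rewrite gt_eqF.
  by rewrite /del -[X in _ + X]mulr_natr natrM; field; rewrite !gt_eqF.
rewrite lerD//; first by rewrite ler_wpM2r ?invr_ge0 ?(ltW del0).
by rewrite ler_wpMn2l// ltW.
Qed.

Lemma sparse_discretization_normalized D (K : R) (v : nat) xi : 0 < K ->
  (0 < v)%N -> bessel mu Om psi K -> uniq D -> (forall x, x \in xi -> Om x) ->
  (forall a : 'I_(size D) -> Cx R, coef_norm a <= Num.sqrt (8 * v%:R * K) ->
    \int[mu]_(x in Om) (normc (comb (dict psi (D:=D)) a x) ^+ 2) = 1 ->
    1 <= 88 * average xi (fun x => normc (comb (dict psi (D:=D)) a x) ^+ 2)) ->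
  sparse_discretization D (2 * v) xi.
Proof.
move=> K0 v0 bes uD Oxi H Q c uQ QD sQ.
set U := \int[mu]_(x in Om) _.
have U0 : 0 <= U by apply: Rintegral_ge0 => x _; exact: sqr_ge0.
have hav := @average_pos_linear R _ _ _ _ Oxi; have [_ avZ _] := hav.
have hmu := Rintegral_pos_linear mOm muOm; have [_ muZ _] := hmu.
have bu := bmeas_normc_sqr (cbmeas_lincomb Q c).
have [U00|Upos] := leP U 0.
  rewrite (le_trans U00)// mulr_ge0// (pos_linear_ge0 hav)// => x _.
  exact: sqr_ge0.
pose z : Cx R := real_complex R (Num.sqrt U)^-1.
have zE x : normc (lincomb psi Q (fun k => z * c k) x) ^+ 2 =
    U^-1 * normc (lincomb psi Q c x) ^+ 2.
  rewrite lincombZ ComplexField.Normc.normcM exprMn normc_real.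
  by rewrite real_normK ?num_real// exprVn sqr_sqrtr.
have I1 : \int[mu]_(x in Om) (normc (lincomb psi Q (fun k => z * c k) x) ^+ 2) = 1.
  under eq_Rintegral => x _ do rewrite zE.
  by rewrite muZ// mulVf// gt_eqF.
have := H (@restrict_coef R d D Q (fun k => z * c k)).
have cE x := comb_restrict psi (fun k => z * c k) x uD uQ QD.
under eq_Rintegral => x _ do rewrite cE.
under [X in average xi X]eq_fun => x do rewrite cE zE.
rewrite avZ// => /(_ _ I1); rewrite mulrCA ler_pdivlMl// mulr1; apply.
apply: le_trans (coef_norm_restrict _ uD uQ QD) _.
exact: (bessel_coef_norm K0 v0 bes uQ sQ I1).
Qed.

End Sampling.

Section SparseApproximation.
Context {R : realType} {d : nat}.
Variables (Om : set (Rd R d)) (mu : {measure set (Rd R d) -> \bar R}).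
Hypotheses (mOm : measurable Om) (muOm : mu Om = 1%E).
Variable psi : 'rV[int]_d -> 'rV[R]_d -> Cx R.
Hypothesis psi_bmeas : forall k, cbmeas Om (psi k).
Hypothesis psi_le1 : forall k x, Om x -> normc (psi k x) <= 1.
Variables (beta E : R) (v : nat) (D low : seq 'rV[int]_d).
Hypotheses (beta_gt0 : 0 < beta) (beta_le1 : beta <= 1) (E_gt0 : 0 < E).
Hypotheses (v_gt0 : (0 < v)%N) (D_uniq : uniq D).
Hypothesis size_low : (size low <= v)%N.
Variable b : 'rV[int]_d -> Cx R.
Hypothesis b_tail : forall Q, uniq Q -> (forall k, k \in Q -> k \notin low) ->
  \sum_(k <- Q) normc (b k) `^ beta <= E.

(** The t with v t^beta = 2E: at most v/2 coefficients off [low] can exceed it. *)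
Definition threshold := (2 * E / v%:R) `^ beta^-1.

Definition kept (k : 'rV[int]_d) := (k \in low) || (threshold < normc (b k)).

(** Below the threshold t, |b| <= t^(1 - beta) |b|^beta. The factor 2 again counts real and
    imaginary parts. *)
Definition rest_norm := 2 * (threshold `^ (1 - beta) * E).

Let v_gt0' : (0 : R) < v%:R. Proof. by rewrite ltr0n. Qed.

Lemma threshold_gt0 : 0 < threshold.
Proof. by rewrite powR_gt0// divr_gt0// mulr_gt0. Qed.

Lemma size_kept : (size [seq k <- D | kept k] <= v + v./2)%N.
Proof.
pose D3 := [seq k <- D | (k \notin low) && (threshold < normc (b k))].
have sD3 : (size D3 <= v./2)%N.
  have : \sum_(k <- D3) threshold `^ beta <= E.
    apply: (@le_trans _ _ (\sum_(k <- D3) normc (b k) `^ beta)).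
      rewrite big_seq [leRHS]big_seq; apply: ler_sum => k.
      rewrite mem_filter => /andP[/andP[_ tk] _].
      by apply: powR_homo; rewrite ltW// threshold_gt0.
    by apply: b_tail => [|k]; rewrite ?filter_uniq// mem_filter => /andP[/andP[]].
  have -> : threshold `^ beta = 2 * E / v%:R.
    by rewrite /threshold -powRrM mulVf ?gt_eqF// powRr1// divr_ge0 ?mulr_ge0// ltW.
  rewrite big_const_seq count_predT iter_addr_0 -[_ *+ _]mulr_natr => h.
  have : 2 * (size D3)%:R <= v%:R :> R.
    have : 2 * (size D3)%:R * E <= v%:R * E.
      have -> : 2 * (size D3)%:R * E = v%:R * (2 * E / v%:R * (size D3)%:R).
        by field; rewrite gt_eqF.
      by rewrite ler_pM2l.
    by rewrite ler_pM2r.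
  by rewrite -natrM ler_nat mul2n => h'; rewrite -[size D3]doubleK half_leq.
apply: leq_trans (_ : (size (low ++ D3) <= _)%N); last by rewrite size_cat leq_add.
apply: uniq_leq_size; first by rewrite filter_uniq.
move=> k; rewrite mem_filter mem_cat mem_filter /kept => /andP[].
by case: (k \in low) => //= -> ->.
Qed.

Lemma rest_norm_le :
  2 * \sum_(k <- [seq k <- D | ~~ kept k]) normc (b k) <= rest_norm.
Proof.
rewrite /rest_norm ler_pM2l//; set Q := [seq k <- D | _].
have t0 := threshold_gt0.
apply: (@le_trans _ _ (\sum_(k <- Q) threshold `^ (1 - beta) * normc (b k) `^ beta)).
  rewrite big_seq [leRHS]big_seq; apply: ler_sum => k.
  rewrite mem_filter /kept negb_or -leNgt => /andP[/andP[_ bt] _].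
  have b0 := normc_ge0 (b k); set y := normc (b k) in bt b0 *.
  have [->|y0] := eqVneq y 0; first by rewrite mulr_ge0 ?powR_ge0.
  rewrite -[leLHS]powRr1// -[X in _ `^ X](subrK beta) powRD ?y0 ?implybT//.
  by rewrite ler_wpM2r ?powR_ge0//; apply: powR_homo; rewrite ?subr_ge0.
rewrite -mulr_sumr ler_wpM2l ?powR_ge0//; apply: b_tail.
  by rewrite filter_uniq// filter_uniq.
by move=> k; rewrite mem_filter /kept negb_or => /andP[/andP[]].
Qed.

Variables (m : nat) (xi : seq (Rd R d)).
Hypotheses (size_xi : size xi = m) (m_gt0 : (0 < m)%N).
Hypothesis Om_xi : forall x, x \in xi -> Om x.

Definition maurey_error := rest_norm / Num.sqrt (uphalf v)%:R.

Lemma rest_norm_gt0 : 0 < rest_norm.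
Proof. by rewrite !mulr_gt0// powR_gt0// threshold_gt0. Qed.

Lemma maurey_error_ge0 : 0 <= maurey_error.
Proof. by rewrite divr_ge0 ?sqrtr_ge0// ltW// rest_norm_gt0. Qed.

Lemma expR_half_le2 : expR 2^-1 <= 2 :> R.
Proof.
apply: le_trans (expR_le_quadratic (lexx _)) _.
by rewrite exprVn (_ : 2 ^+ 2 = 4) ?expr2//; lra.
Qed.

(** Kept terms are copied and the rest is replaced by [uphalf v] draws, so at most v + floor(v/2) +
    ceil(v/2) = 2v terms are used. Both summands on the left are nonnegative, so each inherits the
    bound. *)
Lemma exists_sparse_approximation :
  exists (Q : seq 'rV[int]_d) (c : 'rV[int]_d -> Cx R),
  [/\ uniq Q, {subset Q <= D}, (size Q <= 2 * v)%N & forall q : R, 0 < q ->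
    \int[mu]_(x in Om)
        (normc (lincomb psi D b x - lincomb psi Q c x) `^ q) +
      average xi (fun x =>
        normc (lincomb psi D b x - lincomb psi Q c x) `^ q) <=
    16 * (8 * q * maurey_error) `^ q].
Proof.
set A := rest_norm; have A0 : 0 < A := rest_norm_gt0.
set n := uphalf v; have n0 : (0 < n)%N by rewrite /n; lia.
have n0' : (0 : R) < n%:R by rewrite ltr0n.
pose D1 := [seq k <- D | kept k]; pose D2 := [seq k <- D | ~~ kept k].
have uD2 : uniq D2 by rewrite filter_uniq.
have D2D : {subset D2 <= D} by move=> k; rewrite mem_filter => /andP[].
pose a := @restrict_coef R d D D2 b.
have aA : coef_norm a <= A.
  by apply: le_trans (coef_norm_restrict b D_uniq uD2 D2D) rest_norm_le.
have hav := @average_pos_linear R _ _ _ _ Om_xi.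
have hmu := Rintegral_pos_linear mOm muOm.
have hnu := pos_linearD hmu hav.
pose phi bb j (x : Rd R d) := cpart bb (signed_elt (dict psi (D:=D)) j x).
have db i : cbmeas Om (dict psi (D:=D) i) by exact: psi_bmeas.
have d1 i x : Om x -> normc (dict psi (D:=D) i x) <= 1 by exact: psi_le1.
have phib bb j : bmeas Om (phi bb j) by exact: (cbmeas_signed_elt db).
have phi1 bb j x : Om x -> `|phi bb j x| <= 1.
  move=> Ox; apply: le_trans (cpart_le_normc _ _) _.
  exact: (normc_signed_elt d1).
have [s sn Hs] := maurey_moments hnu (signed_weight_ge0 A0 aA)
  (signed_weight_sum1 a A0) phib phi1 n0.
pose g := signed_average (dict psi (D:=D)) A s.
pose pairs (j : option ('I_(size D) * bool * bool)) : seq ('rV[int]_d * Cx R) :=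
  if j is Some (i, c, t) then
    [:: (nth 0 D i, real_complex R (A / (size s)%:R) * signed_unit c t)] else [::].
pose l := [seq (k, b k) | k <- D1] ++ flatten [seq pairs j | j <- s].
pose Q := undup (map fst l).
pose c k := \sum_(q <- l | q.1 == k) q.2.
have uE x : lincomb psi Q c x = lincomb psi D1 b x + g x.
  rewrite -lincomb_pairs big_cat big_map/=; congr (_ + _).
  rewrite big_flatten big_map /g /signed_average mulr_sumr.
  apply: eq_bigr => -[[[i e] t]|] _ /=; last by rewrite big_nil mulr0.
  by rewrite big_seq1/= mulrA.
have hE x : lincomb psi D b x = lincomb psi D1 b x + comb (dict psi (D:=D)) a x.
  by rewrite (lincomb_filter psi D kept) (comb_restrict psi b x D_uniq uD2 D2D).
have eE x : lincomb psi D b x - lincomb psi Q c x =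
    - (g x - comb (dict psi (D:=D)) a x).
  by rewrite uE hE opprB opprD addrACA subrr add0r.
exists Q, c; split.
- exact: undup_uniq.
- move=> k; rewrite mem_undup map_cat mem_cat => /orP[|].
    by rewrite -map_comp map_id mem_filter => /andP[].
  case/mapP => q /flattenP[_ /mapP[[[[i e] t]|] _ ->]] //=.
  by rewrite inE => /eqP -> -> /=; rewrite mem_nth.
- apply: leq_trans (size_undup _) _; rewrite size_map size_cat size_map.
  have sf : (size (flatten [seq pairs j | j <- s]) <= n)%N.
    rewrite -sn size_flatten /shape -map_comp sumnE big_map.
    apply: leq_trans (_ : (\sum_(j <- s) 1 <= _)%N); last by rewrite sum1_size.
    by apply: leq_sum => -[[[i e] t]|] _.
  have := size_kept; rewrite -/D1 => h; have := leq_add h sf.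
  by rewrite /n; lia.
move=> q q0; have {Hs} Hs := Hs q q0.
have [_ nuZ nule] := hnu.
set r := fun x : Rd R d => normc (lincomb psi D b x - lincomb psi Q c x) `^ q.
have br : bmeas Om r.
  apply: bmeas_normc_powR (ltW q0) _; apply: cbmeasB; exact: cbmeas_lincomb.
pose S x := \sum_(bb : bool) `|deviation phi (signed_weight A a) bb s x| `^ q.
have bS : bmeas Om S.
  by apply: bmeas_sum => bb; apply: bmeas_powR (ltW q0) _; exact: bmeas_deviation.
have le_r x : Om x -> r x <= (2 * A / n%:R) `^ q * S x.
  move=> Ox; rewrite /r eE normcN.
  have s0 : (0 < size s)%N by rewrite sn.
  have := signed_average_dev (dict psi (D:=D)) a A0 x s0; rewrite -/(g x) sn.
  rewrite -/phi big_bool/= /S big_bool/=.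
  set y := `|_|; set z := `|_| => h.
  have y0 : 0 <= y by exact: normr_ge0.
  have z0 : 0 <= z by exact: normr_ge0.
  have An0 : 0 <= A / n%:R by rewrite divr_ge0// ltW.
  apply: le_trans (powR_homo (ltW q0) (normc_ge0 _) h) _.
  have -> : (2 * A / n%:R) `^ q = (A / n%:R) `^ q * 2 `^ q.
    by rewrite -mulrA powRM// mulrC.
  rewrite (powRM _ An0 (addr_ge0 y0 z0)) -mulrA ler_wpM2l ?powR_ge0//.
  by rewrite powRD_le// ltW.
apply: le_trans (nule _ _ br (bmeasZ _ bS) le_r) _.
rewrite (nuZ _ _ bS).
apply: le_trans (ler_wpM2l (powR_ge0 _ _) Hs) _.
rewrite Rintegral_cst1// average_cst1 ?size_xi//.
have sq0 : 0 < Num.sqrt n%:R :> R by rewrite sqrtr_gt0.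
have X0 : 0 <= 2 * A / n%:R := divr_ge0 (mulr_ge0 (ler0n _ 2) (ltW A0)) (ltW n0').
have Y0 : 0 <= 4 * q * Num.sqrt n%:R :=
  mulr_ge0 (mulr_ge0 (ler0n _ 4) (ltW q0)) (ltW sq0).
apply: (@le_trans _ _ ((2 * A / n%:R * (4 * q * Num.sqrt n%:R)) `^ q *
    (4 * expR 2^-1 * (1 + 1)))); first by rewrite (powRM q X0 Y0) -!mulrA.
have -> : 2 * A / n%:R * (4 * q * Num.sqrt n%:R) = 8 * q * maurey_error.
  rewrite /maurey_error -/A -/n.
  have {1}-> : n%:R = Num.sqrt n%:R ^+ 2 :> R by rewrite sqr_sqrtr// ltW.
  by field; rewrite gt_eqF.
(* 16 = 4 * 2 * 2, from e^(1/2) <= 2 and total mass 2. *)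
rewrite [leRHS]mulrC -!mulrA ler_wpM2l ?powR_ge0//.
by have := expR_half_le2; lra.
Qed.

End SparseApproximation.

Section RecoveryArithmetic.
Context {R : realType}.

(** One [B] dominates every term of the final estimate; H >= 1/2 and p >= 2 let it absorb the terms
    lacking H or p. *)
Lemma recovery_constants (p H X tau : R) (B := 16 * 128 * p * H * (X + tau)) :
  2 <= p -> 2^-1 <= H -> 0 <= X -> 0 <= tau ->
  [/\ 0 <= B, 16 * (8 * p * X) <= B, H * (16 * 64 * (X + tau)) <= B & tau <= B].
Proof.
move=> p2 H2 X0 tau0; have w0 : 0 <= X + tau by rewrite addr_ge0.
have p0 : 0 <= p by lra.
have BE : B = 16 * 128 * (p * H * (X + tau)) by rewrite /B !mulrA.
have hpX : 0 <= p * X by rewrite mulr_ge0.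
have hpt : 0 <= p * tau by rewrite mulr_ge0.
have hH : p * (X + tau) * 2^-1 <= p * (X + tau) * H by rewrite ler_wpM2l// mulr_ge0.
have hHw : 0 <= H * (X + tau) by rewrite mulr_ge0//; lra.
have hp : H * (X + tau) * 2 <= H * (X + tau) * p by rewrite ler_wpM2l.
have hw : (X + tau) * 2 <= (X + tau) * p by rewrite ler_wpM2l.
by rewrite BE; split; lra.
Qed.

Lemma sqr_le_split (y e z t : R) : 0 <= y -> y <= e + z -> z <= t ->
  y ^+ 2 <= 2 * e ^+ 2 + 2 * t ^+ 2.
Proof.
move=> y0 ye zt; have : y ^+ 2 <= (e + t) ^+ 2 by rewrite ler_pXn2r ?nnegrE//; lra.
by have := sqr_ge0 (e - t); rewrite sqrrB sqrrD; lra.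
Qed.

Lemma discretization_constants (a X w tau : R) : 0 <= X -> 0 <= tau ->
  a <= 2 * (16 * (16 * X) ^+ 2) + 2 * (2 * tau) ^+ 2 ->
  88 * a <= (16 * 64 * (X + tau)) ^+ 2.
Proof.
move=> X0 tau0; rewrite !exprMn sqrrD.
have : 0 <= X * tau by rewrite mulr_ge0.
have := sqr_ge0 X; have := sqr_ge0 tau; lra.
Qed.

End RecoveryArithmetic.

Section RecoveryBound.
Context {R : realType} {d : nat}.
Variables (Om : set (Rd R d)) (mu : {measure set (Rd R d) -> \bar R}).
Hypotheses (mOm : measurable Om) (muOm : mu Om = 1%E).
Variable psi : 'rV[int]_d -> 'rV[R]_d -> Cx R.
Hypothesis psi_bmeas : forall k, cbmeas Om (psi k).
Hypothesis psi_le1 : forall k x, Om x -> normc (psi k x) <= 1.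

(** [F] stands for the recovery error and [b] for the difference of two coefficient families. With h
    the truncated difference and u its sparse approximation, |F| <= |h - u| + |u| + tau, and each
    term has L_p norm at most B. *)
Lemma recovery_bound (beta E p H tau : R) (v : nat) (D low : seq 'rV[int]_d)
    (b : 'rV[int]_d -> Cx R) (xi : seq (Rd R d)) (F : 'rV[R]_d -> Cx R) :
  0 < beta -> beta <= 1 -> 0 < E -> (0 < v)%N -> uniq D -> (size low <= v)%N ->
  (forall Q, uniq Q -> (forall k, k \in Q -> k \notin low) ->
    \sum_(k <- Q) normc (b k) `^ beta <= E) ->
  (0 < size xi)%N -> (forall x, x \in xi -> Om x) ->
  sparse_discretization Om mu psi D (2 * v) xi ->
  NI mu Om psi p H (2 * v) -> 2 <= p -> 2^-1 <= H -> 0 <= tau ->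
  (forall x, x \in xi -> normc (lincomb psi D b x) <= 2 * tau) ->
  (forall x, Om x -> normc (F x) <= normc (lincomb psi D b x) + tau) ->
  (CLpnorm mu Om p F <=
    (9 * (16 * 128 * p * H * (maurey_error beta E v + tau)))%:E)%E.
Proof.
move=> b0 b1 E0 v0 uD slow tail m0 Oxi disc ni p2 H2 tau0 hxi hF.
have p0 : 0 < p by lra.
have [Q [c [uQ QD sQ app]]] := exists_sparse_approximation mOm muOm psi_bmeas
  psi_le1 b0 b1 E0 v0 uD slow tail erefl m0 Oxi.
have X0 : 0 <= maurey_error beta E v := maurey_error_ge0 beta E0 v0.
set X := maurey_error beta E v in X0 app *; clearbody X.
set h := lincomb psi D b in app hxi hF; set u := lincomb psi Q c in app.
have bh : cbmeas Om h by exact: cbmeas_lincomb.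
have bu : cbmeas Om u by exact: cbmeas_lincomb.
have bhu : cbmeas Om (fun x => h x - u x) by exact: cbmeasB.
have hav := @average_pos_linear R _ _ _ _ Oxi; have [avD avZ avle] := hav.
have hmu := Rintegral_pos_linear mOm muOm; have [muD muZ mule] := hmu.
set w := X + tau; have w0 : 0 <= w by rewrite addr_ge0.
have av2 : average xi (fun x => normc (h x - u x) ^+ 2) <= 16 * (16 * X) ^+ 2.
  have := app 2 ltac:(by []); rewrite (_ : 8 * 2 = 16); last by ring.
  rewrite powR_mulrn ?mulr_ge0// => app2; apply: le_trans app2.
  under [X in average xi X]eq_fun => x do rewrite -powR_mulrn ?normc_ge0//.
  by rewrite lerDr Rintegral_powR_ge0.
(* At the sample points h is of tail size, so u is small there although it carries all the large
   coefficients. *)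
have avu : average xi (fun x => normc (u x) ^+ 2) <=
    2 * (16 * (16 * X) ^+ 2) + 2 * (2 * tau) ^+ 2.
  apply: (@le_trans _ _ (average xi (fun x => 2 * normc (h x - u x) ^+ 2 +
                                              2 * (2 * tau) ^+ 2))).
    rewrite /average ler_wpM2l ?invr_ge0// big_seq [leRHS]big_seq.
    apply: ler_sum => x xxi; have := hxi x xxi.
    apply: sqr_le_split (normc_ge0 _) _.
    rewrite normc_distC; apply: le_trans (normcD _ _).
    by rewrite subrK.
  rewrite avD; [|exact/bmeasZ/bmeas_normc_sqr|exact: bmeas_cst].
  rewrite (avZ _ _ (bmeas_normc_sqr bhu)).
  rewrite (pos_linear_cst hav) average_cst1// mulr1 lerD2r.
  by rewrite ler_pM2l.
have Iu2 : \int[mu]_(x in Om) (normc (u x) ^+ 2) <= (16 * 64 * w) ^+ 2.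
  apply: le_trans (disc Q c uQ QD sQ) _; rewrite -/u.
  exact: discretization_constants.
have Iup : \int[mu]_(x in Om) (normc (u x) `^ p) <= (H * (16 * 64 * w)) `^ p.
  have := ni Q c uQ sQ; rewrite !(CLpnormE mOm muOm)// -/u -EFinM lee_fin.
  rewrite Rintegral_powR2; set P := \int[mu]_(x in Om) _; set U := \int[mu]_(x in Om) _.
  have P0 : 0 <= P by exact: Rintegral_powR_ge0.
  have U0 : 0 <= U by apply: Rintegral_ge0 => x _; exact: sqr_ge0.
  rewrite powR12_sqrt// => PU.
  have -> : P = (P `^ p^-1) `^ p by rewrite -powRrM mulVf ?gt_eqF// powRr1.
  apply: powR_homo; rewrite ?powR_ge0 ?(ltW p0)//; apply: le_trans PU _.
  rewrite ler_wpM2l//; first exact: le_trans H2.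
  rewrite -[leRHS]ger0_norm ?mulr_ge0// -sqrtr_sqr ler_sqrt//.
  exact: sqr_ge0.
have Ihu : \int[mu]_(x in Om) (normc (h x - u x) `^ p) <= (16 * (8 * p * X)) `^ p.
  have y0 : 0 <= 8 * p * X by rewrite !mulr_ge0// ltW.
  rewrite powRM//; apply: (@le_trans _ _ (16 * (8 * p * X) `^ p)).
    apply: le_trans (app p p0); rewrite lerDl.
    apply: (pos_linear_ge0 hav); first exact: (bmeas_normc_powR (ltW p0) bhu).
    by move=> x _; exact: powR_ge0.
  rewrite ler_wpM2r ?powR_ge0// -[leLHS]powRr1//.
  by apply: ler_powR => //; lra.
have H0 : 0 <= H by apply: le_trans H2.
have [B0 B1 B2 B3] := recovery_constants p2 H2 X0 tau0.
rewrite -/w in B0 B1 B2 B3 *; set B := 16 * 128 * p * H * w in B0 B1 B2 B3 *.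
clearbody B.
pose g x := normc (h x - u x) + normc (u x) + tau.
have g0 x : 0 <= g x by rewrite !addr_ge0 ?normc_ge0.
have bg : bmeas Om g.
  by apply: bmeasD; [apply: bmeasD; exact: bmeas_normc|exact: bmeas_cst].
apply: (CLpnorm_le mOm muOm p0 _ (bmeas_powR (ltW p0) bg)).
- by rewrite mulr_ge0.
- move=> x Ox; apply: le_trans (hF x Ox) _; rewrite /g lerD2r.
  by have := normcD (h x - u x) (u x); rewrite subrK.
have bp1 := bmeas_normc_powR (ltW p0) bhu.
have bp2 := bmeas_normc_powR (ltW p0) bu.
have b12 : bmeas Om (fun x => normc (h x - u x) `^ p + normc (u x) `^ p) by exact: bmeasD.
apply: (@le_trans _ _ (\int[mu]_(x in Om) (3 `^ p *
   (normc (h x - u x) `^ p + normc (u x) `^ p + tau `^ p)))).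
  apply: mule => [||x Ox].
  - exact: (bmeas_powR (ltW p0) bg).
  - by apply: bmeasZ; apply: bmeasD => //; exact: bmeas_cst.
  - by rewrite ger0_norm// powRD3_le ?normc_ge0// ltW.
rewrite muZ; last by apply: bmeasD => //; exact: bmeas_cst.
rewrite (muD _ _ b12 (bmeas_cst _ _)) (muD _ _ bp1 bp2).
rewrite (pos_linear_cst hmu) Rintegral_cst1// mulr1.
(* One factor 3 is that of [powRD3_le]; the other absorbs the number of terms, as 3 <= 3^p. *)
have -> : 9 * B = 3 * (3 * B) by ring.
rewrite (powRM _ (ler0n _ 3) (mulr_ge0 (ler0n _ 3) B0)) ler_wpM2l ?powR_ge0//.
apply: (@le_trans _ _ (3 * B `^ p)).
  rewrite (_ : 3 * B `^ p = B `^ p + B `^ p + B `^ p); last by ring.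
  apply: lerD; first apply: lerD.
  - apply: le_trans Ihu _; apply: powR_homo (ltW p0) _ B1.
    by rewrite !mulr_ge0// ltW.
  - by apply: le_trans Iup _; apply: powR_homo (ltW p0) _ B2; rewrite !mulr_ge0.
  - exact: powR_homo (ltW p0) tau0 B3.
rewrite powRM// ler_wpM2r ?powR_ge0// -[leLHS]powRr1//.
by apply: ler_powR => //; lra.
Qed.

End RecoveryBound.

(** * Rates and parameters *)

Section Rates.
Context {R : realType}.
Implicit Types (r beta : R) (v d g : nat).

Lemma ln2_ge_half : 2^-1 <= ln 2 :> R.
Proof. by rewrite -[leLHS]expRK ler_ln ?posrE ?expR_gt0// expR_half_le2. Qed.

Lemma powRN_antimono (s x y : R) : 0 <= s -> 0 < x -> x <= y ->
  y `^ (- s) <= x `^ (- s).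
Proof.
move=> s0 x0 xy; rewrite !powRN lef_pV2 ?posrE ?powR_gt0//; last exact: lt_le_trans xy.
by apply: powR_homo => //; exact: ltW.
Qed.

Definition rate r beta d v : R := v%:R `^ (2^-1 - beta^-1 - r / d%:R).

Definition ratio r beta : R := 2 `^ (- (r * beta)).

Lemma ratio_pow r beta J : 0 < beta ->
  (ratio r beta ^+ J) `^ beta^-1 = (2 ^ J)%:R `^ (- r).
Proof.
move=> b0; rewrite /ratio natrX -(powR_mulrn J (powR_ge0 _ _)).
rewrite -(powR_mulrn J (ler0n _ 2)) -!powRrM.
by congr (_ `^ _); field; rewrite gt_eqF.
Qed.

(** Since v t^beta = 2E, the error is v t / sqrt(ceil(v/2)), of order sqrt(v) t, where t is of order
    v^(-1/beta) 2^(-rJ). As J is the largest exponent with 2^(dJ) <= v, 2^(-rJ) <= 2^r v^(-r/d). *)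
Lemma maurey_error_le r beta d v : 0 < r -> 0 < beta -> beta <= 1 ->
  (0 < d)%N -> (0 < v)%N ->
  maurey_error beta (4 * (ratio r beta ^+ trunc_log (2 ^ d) v /
      (1 - ratio r beta))) v <=
    2 * 2 `^ r * (8 / (1 - ratio r beta)) `^ beta^-1 * rate r beta d v.
Proof.
move=> r0 b0 b1 d0 v0; have q1 : ratio r beta < 1 by exact: pow2_lt1.
set q := ratio r beta in q1 *; set J := trunc_log _ _.
set E := 4 * (q ^+ J / (1 - q)).
have v0' : (0 : R) < v%:R by rewrite ltr0n.
have q0 : 0 < 1 - q by rewrite subr_gt0.
have qJ0 : 0 < q ^+ J by rewrite exprn_gt0// powR_gt0.
have E0 : 0 < E by rewrite mulr_gt0// divr_gt0.
have EE : E = 4 * (q ^+ J / (1 - q)) by [].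
have qP : (q ^+ J) `^ beta^-1 = (2 ^ J)%:R `^ (- r) by exact: ratio_pow.
clearbody E q; have t0 := threshold_gt0 beta E0 v0.
set t := threshold beta E v in t0.
have tE : E = v%:R * t `^ beta / 2.
  rewrite /t /threshold -powRrM mulVf ?gt_eqF// powRr1 ?divr_ge0 ?mulr_ge0 ?(ltW E0)//.
  by field; rewrite gt_eqF.
have -> : maurey_error beta E v = v%:R * t / Num.sqrt (uphalf v)%:R.
  rewrite /maurey_error /rest_norm -/t tE; congr (_ / _).
  have : t `^ (1 - beta) * t `^ beta = t.
    by rewrite -powRD ?(gt_eqF t0) ?implybT// subrK powRr1// ltW.
  by move=> {3}<-; field.
have n0 : (0 : R) < (uphalf v)%:R by rewrite ltr0n; lia.
have sq : v%:R / Num.sqrt (uphalf v)%:R <= 2 * v%:R `^ 2^-1 :> R.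
  rewrite powR12_sqrt// ler_pdivrMr ?sqrtr_gt0//.
  rewrite -{1}[v%:R]sqr_sqrtr// expr2 [2 * _]mulrC -mulrA ler_wpM2l ?sqrtr_ge0//.
  rewrite -(@ler_pXn2r _ 2)// ?nnegrE ?mulr_ge0 ?sqrtr_ge0//.
  rewrite exprMn !sqr_sqrtr// (_ : 2 ^+ 2 = 4%:R) ?expr2; last by ring.
  by rewrite -natrM ler_nat; lia.
have tle : t <= (8 / (1 - q)) `^ beta^-1 * (2 `^ r * v%:R `^ (- (r / d%:R))) *
    v%:R `^ (- beta^-1).
  have -> : t = (8 / (1 - q)) `^ beta^-1 * (2 ^ J)%:R `^ (- r) * v%:R `^ (- beta^-1).
    rewrite /t /threshold (_ : 2 * E / v%:R = 8 / (1 - q) * q ^+ J * v%:R^-1); last first.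
      by rewrite EE; field; rewrite !gt_eqF.
    have h8 : 0 <= 8 / (1 - q) := divr_ge0 (ler0n _ 8) (ltW q0).
    have hv : 0 <= v%:R^-1 :> R by rewrite invr_ge0.
    rewrite (powRM _ (mulr_ge0 h8 (ltW qJ0)) hv) (powRM _ h8 (ltW qJ0)) qP.
    by rewrite -(powR_inv1 (ltW v0')) -powRrM mulN1r.
  rewrite ler_wpM2r ?powR_ge0// ler_wpM2l ?powR_ge0//.
  have -> : 2 `^ r * v%:R `^ (- (r / d%:R)) = (v%:R `^ d%:R^-1 / 2) `^ (- r).
    rewrite powRM ?powR_ge0 ?invr_ge0// mulrC -powRrM; congr (_ * _).
      by congr (_ `^ _); ring.
    by rewrite -powR_inv1// -powRrM mulN1r opprK.
  apply: powRN_antimono; [exact: ltW|by rewrite divr_gt0 ?powR_gt0|].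
  have lt : (v < (2 ^ J.+1) ^ d)%N.
    by rewrite -expnM mulnC expnM trunc_log_ltn// -[1%N](expn0 2) ltn_exp2l.
  rewrite ler_pdivrMr// -natrM mulnC -expnS.
  rewrite -[leRHS]powRr1// -[X in _ <= _ `^ X](@mulfV _ d%:R) ?pnatr_eq0 -?lt0n//.
  rewrite powRrM powR_mulrn// -natrX; apply: powR_homo; rewrite ?invr_ge0 ?ler0n//.
  by rewrite ler_nat ltnW.
rewrite mulrAC; apply: le_trans (ler_pM _ (ltW t0) sq tle) _.
  by rewrite divr_ge0// ltW.
rewrite /rate !powRD ?(gt_eqF v0') ?implybT//.
by rewrite le_eqVlt; apply/orP; left; apply/eqP; ring.
Qed.

Definition tail_bound r beta J : R :=
  (ratio r beta ^+ J / (1 - ratio r beta)) `^ beta^-1.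

(** The cutoff 2^J is at least v^g, so 2^(-rJ) <= v^(-rg), and rg >= 1/beta + r/d is already enough
    for the rate. *)
Lemma tail_bound_le r beta d v g : 0 < r -> 0 < beta -> (0 < v)%N ->
  (beta^-1 + r / d%:R) / r <= g%:R ->
  tail_bound r beta (up_log 2 v * g) <=
    (1 - ratio r beta)^-1 `^ beta^-1 * rate r beta d v.
Proof.
move=> r0 b0 v0 hg; have q1 : ratio r beta < 1 by exact: pow2_lt1.
have v1 : (1 : R) <= v%:R by rewrite ler1n.
rewrite /tail_bound mulrC powRM ?invr_ge0 ?subr_ge0 ?(ltW q1) ?exprn_ge0 ?powR_ge0//.
rewrite ler_wpM2l ?powR_ge0// ratio_pow//.
have -> : (2 ^ (up_log 2 v * g))%:R `^ (- r) = (2 ^ up_log 2 v)%:R `^ (- (r * g%:R)) :> R.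
  rewrite expnM natrX -powR_mulrn// -powRrM; congr (_ `^ _); ring.
apply: (@le_trans _ _ (v%:R `^ (- (r * g%:R)))).
  apply: powRN_antimono; rewrite ?mulr_ge0 ?(ltW r0) ?ltr0n//.
  by rewrite ler_nat up_logP.
apply: ler_powR => //; move: hg; rewrite ler_pdivrMr// mulrC; lra.
Qed.

Lemma tail_bound_ge0 r beta J : 0 <= tail_bound r beta J.
Proof. exact: powR_ge0. Qed.

(** Every entry is at most t = E^(1/beta), so |a| <= t^(1 - beta) |a|^beta; summing gives t. *)
Lemma sum_normc_le_lbeta (I : eqType) beta (E : R) (Q : seq I) (a : I -> Cx R) :
  0 < beta -> beta <= 1 -> \sum_(k <- Q) normc (a k) `^ beta <= E ->
  \sum_(k <- Q) normc (a k) <= E `^ beta^-1.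
Proof.
move=> b0 b1 aE.
have E0 : 0 <= E by apply: le_trans aE; apply: sumr_ge0 => k _; exact: powR_ge0.
set t := E `^ beta^-1; have tE : t `^ beta = E.
  by rewrite -powRrM mulVf ?gt_eqF// powRr1.
have t0 : 0 <= t by exact: powR_ge0.
have at_ k : k \in Q -> normc (a k) <= t.
  move=> kQ; have -> : normc (a k) = (normc (a k) `^ beta) `^ beta^-1.
    by rewrite -powRrM mulfV ?gt_eqF// powRr1// normc_ge0.
  apply: powR_homo; rewrite ?invr_ge0 ?powR_ge0 ?(ltW b0)//.
  apply: le_trans aE; rewrite (big_rem k)//= lerDl.
  by apply: sumr_ge0 => i _; exact: powR_ge0.
have [t00|tn0] := eqVneq t 0.
  rewrite t00 big_seq big1// => k /at_; rewrite t00 => h.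
  by apply/eqP; rewrite eq_le h normc_ge0.
apply: (@le_trans _ _ (\sum_(k <- Q) t `^ (1 - beta) * normc (a k) `^ beta)).
  rewrite big_seq [leRHS]big_seq; apply: ler_sum => k /at_ kt.
  have := normc_ge0 (a k); set y := normc (a k) in kt *; move=> y0.
  have [->|yn0] := eqVneq y 0; first by rewrite mulr_ge0 ?powR_ge0.
  rewrite -[leLHS]powRr1// -[X in _ `^ X](subrK beta) powRD ?yn0 ?implybT//.
  by rewrite ler_wpM2r ?powR_ge0//; apply: powR_homo; rewrite ?subr_ge0.
rewrite -mulr_sumr; apply: le_trans (ler_wpM2l (powR_ge0 _ _) aE) _.
by rewrite -tE -powRD ?tn0 ?implybT// subrK powRr1.
Qed.

(** The levels are balanced: 4^i times [level_size] is of order s Lam + 4^i. The sum is therefore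
    dominated by L s Lam lJ, where L, Lam and lJ are each O(log v). The fourth logarithm of the
    hypothesis is only used through 2 ln(2v) >= 1. *)
Lemma exists_level_parameters (K cJ : R) : 1 <= K -> 0 <= cJ ->
  exists c : R, 0 < c /\ forall (v m : nat) (lJ : R) (s := 8 * v%:R * K),
    (0 < v)%N -> 0 <= lJ -> lJ <= cJ * ln (2 * v%:R) ->
    c * v%:R * ln (2 * v%:R) ^+ 4 <= m%:R ->
  (0 < m)%N /\ exists (L : nat) (Lam : R),
  [/\ s <= 4 ^+ L, 4 ^+ L <= 4 * s,
    16 * expR (- Lam) * \sum_(i < L.+1) 4 ^+ i <= 8^-1 &
    \sum_(i < L.+1) 4 ^+ i *
      (2 * (ln 2 + (ln L.+1%:R + (level_size s Lam i)%:R * lJ)) / m%:R) <= 8^-1].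
Proof.
move=> K1 cJ0; have K0 : 0 < K by exact: lt_le_trans K1.
(* Constants for L + 1 <= cM l and Lam <= cL l with l = ln(2v); additive constants are absorbed by 1
   <= 2l. *)
pose cM : R := 2 * ln (16 * K) + 3.
pose cL : R := 2 * ln (16 * 6 * 8 * 4 * K) + 1.
have cM0 : 0 < cM.
  by rewrite /cM; have : 0 <= ln (16 * K) by [rewrite ln_ge0//; lra]; lra.
have cL0 : 0 < cL.
  by rewrite /cL; have : 0 <= ln (16 * 6 * 8 * 4 * K) by [rewrite ln_ge0//; lra]; lra.
pose W : R := (6 * (4 + cM) + 6 * cJ) * 8 + 16 * 16 * 32 * 2 * (cM * cL * cJ).
have W0 : 0 < W.
  have : 0 <= cM * cL * cJ by rewrite !mulr_ge0// ltW.
  by rewrite /W; lra.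
exists (128 * K * W); split; first by rewrite !mulr_gt0.
move=> v m lJ s v0 lJ0 lJle hm.
have v1 : (1 : R) <= v%:R by rewrite ler1n.
have v0' : (0 : R) < v%:R by rewrite ltr0n.
set l := ln (2 * v%:R) in lJle hm.
have l2 : 1 <= 2 * l.
  have : ln 2 <= l by rewrite ler_ln ?posrE//; lra.
  by have := ln2_ge_half; lra.
have l0 : 0 < l by lra.
have m0 : (0 : R) < m%:R.
  by apply: lt_le_trans hm; rewrite !mulr_gt0// exprn_gt0.
split; first by rewrite -(ltr0n R).
have s8 : 8 <= s.
  by rewrite /s -mulrA ler_peMr// mulr_ege1.
have s0 : 0 < s by lra.
have exL : exists L : nat, s <= 4 ^+ L.
  exists (Num.trunc s).+1; apply: le_trans (ltW (truncnS_gt s)) _.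
  by rewrite -natrX ler_nat ltnW// ltn_expl.
case: (ex_minnP exL) => L sL minL.
have Ls : 4 ^+ L <= 4 * s.
  case: L sL minL => [|L] sL minL; first by rewrite expr0; lra.
  rewrite exprS ler_pM2l// leNgt; apply/negP => /ltW/minL.
  by rewrite ltnn.
have S6 : \sum_(i < L.+1) (4 : R) ^+ i <= 6 * s.
  by rewrite sum_pow4 exprS; lra.
have S0 : 0 <= \sum_(i < L.+1) (4 : R) ^+ i.
  by apply: sumr_ge0 => i _; rewrite exprn_ge0.
have sK : 4 * s = 16 * K * (2 * v%:R) by rewrite /s; ring.
have M_le : L.+1%:R <= cM * l.
  have lnL : L%:R <= ln (4 * s).
    have : ln (4 ^+ L) <= ln (4 * s) by rewrite ler_ln ?posrE ?exprn_gt0//; lra.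
    rewrite lnXn// -[_ *+ L]mulr_natl; apply: le_trans; rewrite ler_peMr//.
    rewrite (_ : 4 = 2 * 2); last by ring.
    by rewrite lnM ?posrE//; have := ln2_ge_half; lra.
  have : 0 <= ln (16 * K) by rewrite ln_ge0//; lra.
  move: lnL; rewrite sK lnM ?posrE ?mulr_gt0// -/l -(natr1 L) /cM => h1 h2.
  have : ln (16 * K) * 1 <= ln (16 * K) * (2 * l) by rewrite ler_wpM2l.
  by lra.
(* Chosen so that 16 e^-Lam (6s) = 1/8. *)
pose Lam : R := ln (16 * 6 * 8 * s).
have LamE : expR (- Lam) = (16 * 6 * 8 * s)^-1.
  by rewrite expRN lnK// posrE !mulr_gt0.
have Lam0 : 0 <= Lam by rewrite ln_ge0//; lra.
have Lam_le : Lam <= cL * l.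
  have h2 : 0 <= ln (16 * 6 * 8 * 4 * K) by rewrite ln_ge0//; lra.
  rewrite /Lam (_ : 16 * 6 * 8 * s = 16 * 6 * 8 * 4 * K * (2 * v%:R)); last first.
    by rewrite /s; ring.
  rewrite lnM ?posrE ?mulr_gt0// -/l /cL.
  have : ln (16 * 6 * 8 * 4 * K) * 1 <= ln (16 * 6 * 8 * 4 * K) * (2 * l).
    by rewrite ler_wpM2l.
  by lra.
exists L, Lam; split => //.
  rewrite LamE; apply: (@le_trans _ _ (16 * (16 * 6 * 8 * s)^-1 * (6 * s))).
    by rewrite ler_wpM2l// mulr_ge0// invr_ge0 !mulr_ge0// ltW.
  rewrite le_eqVlt; apply/orP; left; apply/eqP; field.
  by rewrite gt_eqF.
set S := \sum_(i < L.+1) 4 ^+ i in S6 S0.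
pose Z : R := S * (2 + L.+1%:R) + (L.+1%:R * (16 * 16 * 32 * s * Lam) + S) * lJ.
apply: (@le_trans _ _ (2 / m%:R * Z)).
  have -> : Z = \sum_(i < L.+1) (4 ^+ i * (2 + L.+1%:R) +
      (16 * 16 * 32 * s * Lam + 4 ^+ i) * lJ).
    rewrite big_split/= -!mulr_suml big_split/= sumr_const card_ord.
    by rewrite -[_ * Lam *+ L.+1]mulr_natl /Z.
  rewrite mulr_sumr; apply: ler_sum => i _.
  have p4 : (0 : R) < 4 ^+ i by rewrite exprn_gt0.
  have ln2 : ln 2 <= 2 :> R by rewrite ltW// ln_sublinear.
  have lnM' : ln L.+1%:R <= L.+1%:R :> R by rewrite ltW// ln_sublinear ?ltr0n.
  have n_le : 4 ^+ i * (level_size s Lam i)%:R <= 16 * 16 * 32 * s * Lam + 4 ^+ i.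
    rewrite /level_size -(natr1 (Num.trunc _)) mulrDr mulr1 lerD2r mulrC -ler_pdivlMr//.
    rewrite truncn_le; apply: divr_ge0 (ltW p4).
    by rewrite !mulr_ge0// ltW.
  rewrite (_ : 4 ^+ i * _ = 2 / m%:R * (4 ^+ i * (ln 2 + ln L.+1%:R) +
      4 ^+ i * (level_size s Lam i)%:R * lJ)); last by field; rewrite gt_eqF.
  rewrite ler_wpM2l ?divr_ge0 ?(ltW m0)// lerD//.
    by rewrite ler_wpM2l ?(ltW p4)// lerD.
  by rewrite ler_wpM2r.
have Zle : Z <= s * W * l ^+ 4.
  have l3 : l <= 8 * l ^+ 4.
    have -> : 8 * l ^+ 4 = l * (2 * l) ^+ 3 by ring.
    by rewrite ler_peMr ?(ltW l0)// exprn_ege1.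
  have l34 : l ^+ 3 <= 2 * l ^+ 4.
    have -> : 2 * l ^+ 4 = l ^+ 3 * (2 * l) by ring.
    by rewrite ler_peMr// exprn_ge0// ltW.
  have t1 : S * (2 + L.+1%:R) <= 6 * s * ((4 + cM) * l).
    by apply: ler_pM => //; lra.
  have t2 : S * lJ <= 6 * s * (cJ * l) by exact: ler_pM.
  have t3 : L.+1%:R * Lam * lJ <= cM * cL * cJ * l ^+ 3.
    have -> : cM * cL * cJ * l ^+ 3 = cM * l * (cL * l) * (cJ * l) by ring.
    by apply: ler_pM => //; [exact: mulr_ge0|exact: ler_pM].
  have t4 : s * (L.+1%:R * Lam * lJ) <= s * (cM * cL * cJ * (2 * l ^+ 4)).
    rewrite ler_pM2l//; apply: le_trans t3 _.
    by rewrite ler_wpM2l// !mulr_ge0// ltW.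
  have t5 : s * (6 * (4 + cM) + 6 * cJ) * l <= s * (6 * (4 + cM) + 6 * cJ) * (8 * l ^+ 4).
    by rewrite ler_wpM2l// mulr_ge0 ?(ltW s0)//; lra.
  rewrite /Z /W; move: t1 t2 t4 t5; clear; nra.
apply: (@le_trans _ _ (2 / m%:R * (s * W * l ^+ 4))).
  by rewrite ler_wpM2l ?divr_ge0 ?(ltW m0).
rewrite mulrAC ler_pdivrMr//; move: hm; rewrite /s.
have -> : 128 * K * W * v%:R * l ^+ 4 = 8 * (2 * (8 * v%:R * K * W * l ^+ 4)) by ring.
by lra.
Qed.

End Rates.

(** * Tails of the class and final assembly *)

Section ClassTail.
Context {R : realType} {d : nat}.
Variables (Om : set 'rV[R]_d) (psi : 'rV[int]_d -> 'rV[R]_d -> Cx R).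
Hypothesis psi_le1 : unif_bounded Om psi.

(** Compare f with a finite sum containing both the box and the frequencies needed for accuracy e.
    What lies off the box is bounded by its l_1 norm, uniformly in x. *)
Lemma class_tail (r beta : R) (J : nat) (f : 'rV[R]_d -> Cx R)
    (a : 'rV[int]_d -> Cx R) : 0 < r -> 0 < beta -> beta <= 1 ->
  (forall (j : nat) (Q : seq 'rV[int]_d), uniq Q -> all (dyadic_block j) Q ->
     (\sum_(k <- Q) normc (a k) `^ beta) `^ beta^-1 <= 2 `^ (- r * j%:R)) ->
  (forall x, Om x -> forall e : R, 0 < e -> exists Q0 : seq 'rV[int]_d,
     forall Q : seq 'rV[int]_d, uniq Q -> {subset Q0 <= Q} ->
       normc (f x - lincomb psi Q a x) <= e) ->
  forall x, Om x ->
    normc (f x - lincomb psi (box d J) a x) <= tail_bound r beta J.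
Proof.
move=> r0 b0 b1 ablk fsum x Ox; apply/ler_addgt0Pr => e e0.
have [Q0 HQ0] := fsum x Ox e e0.
pose Q := undup (box d J ++ Q0).
have uQ : uniq Q by exact: undup_uniq.
have /HQ0 fQ : {subset Q0 <= Q} by move=> k kQ; rewrite mem_undup mem_cat kQ orbT.
pose Q1 := [seq k <- Q | k \notin box d J].
have QE : lincomb psi Q a x = lincomb psi (box d J) a x + lincomb psi Q1 a x.
  rewrite (lincomb_filter psi Q (fun k => k \in box d J)); congr (_ + _).
  apply: perm_big; apply: uniq_perm; rewrite ?filter_uniq ?box_uniq// => k.
  by rewrite mem_filter andb_idr// => kJ; rewrite mem_undup mem_cat kJ.
have -> : f x - lincomb psi (box d J) a x =
    lincomb psi Q1 a x + (f x - lincomb psi Q a x) by rewrite QE; ring.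
apply: le_trans (normcD _ _) _; apply: lerD; last exact: fQ.
apply: (@le_trans _ _ (\sum_(k <- Q1) normc (a k))).
  apply: le_trans (normc_sum _ _) _; apply: ler_sum => k _.
  by rewrite ComplexField.Normc.normcM ler_piMr ?normc_ge0 ?psi_le1.
apply: sum_normc_le_lbeta => //; apply: (tail_sum_le r0 b0 ablk).
  by rewrite filter_uniq.
by move=> k; rewrite mem_filter => /andP[].
Qed.

(** The constant 4 is 2^beta <= 2 times two tails. *)
Lemma class_diff_tail (r beta : R) (J : nat) (a a' : 'rV[int]_d -> Cx R) :
  0 < r -> 0 < beta -> beta <= 1 ->
  (forall (j : nat) (Q : seq 'rV[int]_d), uniq Q -> all (dyadic_block j) Q ->
     (\sum_(k <- Q) normc (a k) `^ beta) `^ beta^-1 <= 2 `^ (- r * j%:R)) ->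
  (forall (j : nat) (Q : seq 'rV[int]_d), uniq Q -> all (dyadic_block j) Q ->
     (\sum_(k <- Q) normc (a' k) `^ beta) `^ beta^-1 <= 2 `^ (- r * j%:R)) ->
  forall Q, uniq Q -> (forall k, k \in Q -> k \notin box d J) ->
  \sum_(k <- Q) normc (a k - a' k) `^ beta <=
    4 * (ratio r beta ^+ J / (1 - ratio r beta)).
Proof.
move=> r0 b0 b1 ablk a'blk Q uQ QJ.
have h := tail_sum_le r0 b0 ablk uQ QJ; have h' := tail_sum_le r0 b0 a'blk uQ QJ.
rewrite -!/(ratio r beta) in h h'.
apply: (@le_trans _ _ (\sum_(k <- Q) 2 * (normc (a k) `^ beta + normc (a' k) `^ beta))).
  apply: ler_sum => k _.
  apply: le_trans (powR_homo (ltW b0) (normc_ge0 _) (normcB _ _)) _.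
  apply: le_trans (powRD_le (ltW b0) (normc_ge0 _) (normc_ge0 _)) _.
  rewrite ler_wpM2r ?addr_ge0 ?powR_ge0// -[leRHS]powRr1//.
  by apply: ler_powR => //; rewrite ler1n.
by rewrite -mulr_sumr big_split/=; lra.
Qed.

End ClassTail.

(** The box has N <= (2v)^(gd) elements and the dictionary 4N + 1, so its logarithm is O(log v). *)
Lemma ln_card_signed_dict (R : realType) (d v g : nat) : (0 < v)%N ->
  ln (#|{: option ('I_(size (box d (up_log 2 v * g))) * bool * bool)}|%:R : R) <=
  (2 * ln 5 + (g * d)%:R) * ln (2 * v%:R).
Proof.
move=> v0; set N := size _.
have v1 : (1 : R) <= v%:R by rewrite ler1n.
have l2 : 1 <= 2 * ln (2 * v%:R) :> R.
  have : ln 2 <= ln (2 * v%:R) :> R by rewrite ler_ln ?posrE//; lra.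
  by have := @ln2_ge_half R; lra.
have up2 : (2 ^ up_log 2 v <= 2 * v)%N.
  case: v v0 {N v1 l2} => [//|[//|v]] _.
  have /andP[lt _] := @up_log_bounds 2 v.+2 isT isT.
  have : (0 < up_log 2 v.+2)%N by rewrite up_log_gt0.
  by move: lt; case: (up_log _ _) => // k /= lt _; rewrite expnS leq_mul2l ltnW.
have NE : (N <= (2 * v) ^ (g * d))%N.
  apply: leq_trans (size_box d _) _; rewrite -expnM -mulnA expnM.
  by case: (g * d)%N => // n; rewrite leq_exp2r.
rewrite card_option !card_prod card_ord card_bool.
have : ((N * 2 * 2).+1 <= 5 * (2 * v) ^ (g * d))%N.
  have : (0 < (2 * v) ^ (g * d))%N by rewrite expn_gt0 muln_gt0 v0.
  by move: NE; move: ((2 * v) ^ (g * d))%N => P; lia.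
rewrite -(ler_nat R) => h.
have P0 : (0 : R) < (2 * v%:R) ^+ (g * d) by rewrite exprn_gt0//; lra.
apply: (@le_trans _ _ (ln (5 * (2 * v%:R) ^+ (g * d)))).
  rewrite ler_ln ?posrE ?ltr0n ?mulr_gt0//; apply: le_trans h _.
  by rewrite natrM natrX natrM.
rewrite lnM ?posrE// lnXn; last by lra.
rewrite -[ln _ *+ _]mulr_natl [leRHS]mulrDl lerD2r.
have : 0 <= ln 5 :> R by rewrite ln_ge0//; lra.
move=> h5; have : ln 5 * 1 <= ln 5 * (2 * ln (2 * v%:R)) :> R by rewrite ler_wpM2l.
by lra.
Qed.

Theorem theorem5p5 (R : realType) (d : nat) (p beta r : R) :
  (0 < d)%N -> 2 <= p -> 0 < beta <= 1 -> 0 < r ->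
  exists C : R, 0 < C /\
  forall K : R, 0 < K -> exists c : R, 0 < c /\
  forall (Om : set (Rd R d)) (mu : {measure set (Rd R d) -> \bar R})
         (psi : 'rV[int]_d -> 'rV[R]_d -> Cx R),
    compact (Om : set 'rV[R]_d) -> measurable Om -> mu Om = 1%E ->
    (forall k, {within (Om : set 'rV[R]_d), continuous (fun x => complex.Re (psi k x))} /\
               {within (Om : set 'rV[R]_d), continuous (fun x => complex.Im (psi k x))}) ->
    unif_bounded Om psi -> bessel mu Om psi K ->
    forall (v : nat) (H : R), (0 < v)%N -> NI mu Om psi p H (2 * v) ->
    forall m : nat, c * v%:R * (ln (2 * v%:R)) ^+ 4 <= m%:R ->
    (recov_err mu Om p m (classA Om psi r beta)
       <= (C * H * v%:R `^ (2^-1 - beta^-1 - r / d%:R))%:E)%E.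
Proof.
move=> d0 p2 /andP[b0 b1] r0; have p0 : 0 < p by lra.
have q1 : 0 < 1 - ratio r beta by rewrite subr_gt0; exact: pow2_lt1.
set C1 := 2 * 2 `^ r * (8 / (1 - ratio r beta)) `^ beta^-1.
set C2 := (1 - ratio r beta)^-1 `^ beta^-1.
have C10 : 0 < C1 by rewrite !mulr_gt0// powR_gt0// divr_gt0.
have C20 : 0 < C2 by rewrite powR_gt0// invr_gt0.
exists (9 * (16 * 128 * p * (C1 + C2))); split.
  by rewrite !mulr_gt0// addr_gt0.
move=> K K0.
pose g := (Num.trunc ((beta^-1 + r / d%:R) / r)).+1.
(* [c] is fixed before the system is given, so K >= 1 cannot be read off from the Bessel inequality
   here; a larger constant only weakens that inequality. *)
have K1 : 1 <= Num.max K 1 by rewrite le_max lexx orbT.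
have cJ0 : 0 <= 2 * ln 5 + (g * d)%:R :> R.
  by rewrite addr_ge0// mulr_ge0// ln_ge0// ler1n.
have [c [c0 params]] := exists_level_parameters K1 cJ0.
exists c; split => // Om mu psi _ mOm muOm cpsi psi1 bes v H v0 ni m hm.
have psib k : cbmeas Om (psi k).
  have [cre cim] := cpsi k; case; apply: (@within_continuous_bmeas _ _ _ mOm _ 1) => //.
    by move=> x Ox; apply: le_trans (psi1 k x Ox); exact: (cpart_le_normc true).
  by move=> x Ox; apply: le_trans (psi1 k x Ox); exact: (cpart_le_normc false).
(* Two cutoffs: [J], at a power of v, makes the tail negligible; [J0] is the largest one with 2^(d
   J0) <= v, which leaves at most v low frequencies. *)
pose J := (up_log 2 v * g)%N; pose D := box d J.
pose J0 := trunc_log (2 ^ d) v.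
have uD : uniq D by exact: box_uniq.
pose psiD := dict psi (D:=D).
have psiDb i : cbmeas Om (psiD i) by exact: psib.
have psiD1 i x : Om x -> normc (psiD i x) <= 1 by exact: psi1.
have lJ0 : 0 <= ln (#|{: option ('I_(size D) * bool * bool)}|%:R : R).
  by rewrite ln_ge0// ler1n; apply/card_gt0P; exists None.
have [m0 [L [Lam [sL Ls cond1 cond2]]]] :=
  params v m _ v0 lJ0 (@ln_card_signed_dict R d v g v0) hm.
set s := 8 * v%:R * Num.max K 1 in sL Ls cond1 cond2.
have s0 : 0 < s by rewrite !mulr_gt0 ?ltr0n//; exact: lt_le_trans K1.
have [xi [sxi Oxi disc0]] := exists_discretization mOm muOm psiDb psiD1 s0 sL Ls
  m0 cond1 cond2.
have disc : sparse_discretization Om mu psi D (2 * v) xi.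
  apply: (sparse_discretization_normalized mOm muOm psib K0 v0 bes uD Oxi).
  move=> a aK; apply: disc0; apply: le_trans aK _.
  by rewrite ler_sqrt ?(ltW s0)// ler_wpM2l// le_max lexx.
(* Tested on [psi 0], whose L_2 norm is positive by the Bessel inequality. *)
have H2 : 2^-1 <= H.
  pose one (k : 'rV[int]_d) : Cx R := 1.
  pose Q0 : seq 'rV[int]_d := [:: 0].
  have bl : cbmeas Om (lincomb psi Q0 one) by exact: cbmeas_lincomb.
  have v2 : (size Q0 <= 2 * v)%N by rewrite muln_gt0.
  apply: (reverse_Lp_constant_ge_half mOm muOm p2 bl _ (ni Q0 one isT v2)).
  have := bes Q0 one isT; rewrite (CLpnorm2_sqrE mOm muOm bl) -EFinM lee_fin.
  rewrite big_seq1 ComplexField.Normc.normc1 expr1n => h.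
  by rewrite -(pmulr_rgt0 _ K0); exact: lt_le_trans h.
have size_low : (size (box d J0) <= v)%N.
  apply: leq_trans (size_box d J0) _; rewrite -expnM mulnC expnM.
  by apply: trunc_logP => //; rewrite -[1%N](expn0 2) ltn_exp2l.
pose samples (f : 'rV[R]_d -> Cx R) := fun i : 'I_m => f (nth point xi i).
pose coefs f (a : 'rV[int]_d -> Cx R) := [/\
  (exists M : R, forall Q : seq 'rV[int]_d, uniq Q -> \sum_(k <- Q) normc (a k) <= M),
  (forall (j : nat) (Q : seq 'rV[int]_d), uniq Q -> all (dyadic_block j) Q ->
    (\sum_(k <- Q) normc (a k) `^ beta) `^ beta^-1 <= 2 `^ (- r * j%:R)) &
  (forall x, Om x -> forall e : R, 0 < e -> exists Q0 : seq 'rV[int]_d,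
    forall Q : seq 'rV[int]_d, uniq Q -> {subset Q0 <= Q} ->
      normc (f x - lincomb psi Q a x) <= e)].
(* Recovery by consistency: take the coefficients of any class function with samples y, and 0 when
   there is none. *)
have decode (y : 'I_m -> Cx R) : exists a' : 'rV[int]_d -> Cx R,
    (exists f a, coefs f a /\ samples f = y) ->
    exists f, coefs f a' /\ samples f = y.
  have [[f [a [fa fy]]]|no] := pselect (exists f a, coefs f a /\ samples f = y).
    by exists a => _; exists f.
  by exists (fun=> 0) => yes; case: no.
have [rec recP] := choice decode.
(* The output is truncated to [D]: a finite combination lies in L_p for every y, even for data that
   no class function produces. *)
apply: ge_ereal_inf; eexists; first exists (fun i => nth point xi i),
  (fun y => lincomb psi D (rec y)); first split.
- by move=> i; apply: Oxi; rewrite mem_nth// sxi.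
- move=> y; have bl : cbmeas Om (lincomb psi D (rec y)) by exact: cbmeas_lincomb.
  split; [exact: (bl false).1|exact: (bl true).1|].
  by rewrite (CLpnormE mOm muOm p0 bl) ltry.
- reflexivity.
apply: ge_ereal_sup => _ [f [a fa] <-].
have [f' [f'a' ff']] := recP (samples f) (ex_intro _ f (ex_intro _ a (conj fa erefl))).
set a' := rec (samples f) in f'a' *.
have [_ ablk fsum] := fa; have [_ a'blk f'sum] := f'a'.
have ft := class_tail psi1 J r0 b0 b1 ablk fsum.
have f't := class_tail psi1 J r0 b0 b1 a'blk f'sum.
have tail := class_diff_tail (J := J0) r0 b0 b1 ablk a'blk.
have E0 : 0 < 4 * (ratio r beta ^+ J0 / (1 - ratio r beta)).
  by rewrite mulr_gt0// divr_gt0// exprn_gt0// powR_gt0.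
have diffE x : lincomb psi D (fun k => a k - a' k) x =
    lincomb psi D a x - lincomb psi D a' x.
  by rewrite /lincomb -sumrB; apply: eq_bigr => k _; rewrite mulrBl.
have m0' : (0 < size xi)%N by rewrite sxi.
have := recovery_bound mOm muOm psib psi1 b0 b1 E0 v0 uD size_low tail m0' Oxi
  disc ni p2 H2 (tail_bound_ge0 r beta J).
move=> /(_ (fun x => f x - lincomb psi D a' x)) bound.
apply: le_trans (bound _ _) _.
(* As f and f' agree at x, the truncated difference equals a difference of two tails, which gives 2
   tau. *)
- move=> x xxi; have ix : (index x xi < m)%N by rewrite -sxi index_mem.
  have := congr1 (fun h => h (Ordinal ix)) ff'; rewrite /samples/= nth_index// => fx.
  rewrite diffE (_ : _ - _ = (f' x - lincomb psi D a' x) - (f x - lincomb psi D a x)).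
    apply: le_trans (normcB _ _) _; rewrite mulr_natl mulr2n.
    by apply: lerD; [apply: f't|apply: ft]; exact: Oxi.
  by rewrite fx; ring.
- move=> x Ox; rewrite diffE.
  rewrite (_ : f x - _ = (lincomb psi D a x - lincomb psi D a' x) +
    (f x - lincomb psi D a x)); last by ring.
  by apply: le_trans (normcD _ _) _; rewrite lerD2l; exact: ft.
rewrite lee_fin -/(rate r beta d v).
have hg : (beta^-1 + r / d%:R) / r <= g%:R by rewrite ltW// truncnS_gt.
have e1 := maurey_error_le r0 b0 b1 d0 v0.
have e2 := tail_bound_le r0 b0 v0 hg.
have pH0 : 0 <= 16 * 128 * p * H.
  by rewrite !mulr_ge0 ?(ltW p0)//; exact: le_trans H2.
have e12 := lerD e1 e2; rewrite -mulrDl in e12.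
have := ler_wpM2l pH0 e12; rewrite -/C1 -/C2 -/J -/J0.
by move: (maurey_error _ _ _ + _) (rate _ _ _ _) => X Y; lra.
Qed.
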